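(* For every partition $\Pi$ of the time interval $[0,T]$ and all $(t,x)\in[0,T]\times\mathbb R^d$, $$V^\Pi(t,x)=\sup_{\alpha\in\mathcal A^\Pi_{t,T}}\inf_{\beta\in\mathcal B^\Pi_{t,T}}E[g(X_T^{t,x,\alpha,\beta})],\qquad U^\Pi(t,x)=\inf_{\beta\in\mathcal B^\Pi_{t,T}}\sup_{\alpha\in\mathcal A^\Pi_{t,T}}E[g(X_T^{t,x,\alpha,\beta})].$$
   Context: Setting. $T>0$ is fixed, $U,V$ are compact metric spaces, $f:[0,T]\times\mathbb R^d\times U\times V\to\mathbb R^d$ is bounded, continuous, and Lipschitz in $x$ uniformly with respect to $(t,u,v)$, and $g:\mathbb R^d\to\mathbb R$ is bounded and Lipschitz. Probability space. $(\Omega,\mathcal F,P)=\big(([0,1]^2)^{\mathbb N},\mathcal B([0,1]^2)^{\otimes\mathbb N},\lambda_2^{\otimes\mathbb N}\big)$, with $\mathbb N$ the positive integers and $\lambda_2$ two-dimensional Lebesgue (Borel) measure on $[0,1]^2$. The coordinate maps are $\zeta_j=(\zeta_{j,1},\zeta_{j,2}):\Omega\to[0,1]^2$, $j\ge1$. Put $\mathcal G_j=\sigma(\zeta_{j,1})$, $\mathcal H_j=\sigma(\zeta_{j,2})$, $\mathcal F_j=\sigma(\zeta_1,\dots,\zeta_j)$ for $j\ge1$, and $\mathcal F_0$ the trivial $\sigma$-field. $\mathbb F=(\mathcal F_j)$; a random time $\tau:\Omega\to\{0,1,2,\dots\}$ is an $\mathbb F$-stopping time if $\{\tau=j\}\in\mathcal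 F_j$ for all $j\ge0$. Admissible controls. Let $\Pi=\{0=t_0<\dots<t_n=T\}$. For a sub-$\sigma$-field $\mathcal K\subset\mathcal F$, $L^0_{\mathcal K}(a,b;E)$ denotes the (jointly) measurable $E$-valued processes $(u_s)$ on the time interval from $a$ to $b$ with $u_s$ $\mathcal K$-measurable for every $s$. $\mathcal U^\Pi_{0,T}$ is the set of $u\in L^0_{\mathcal F}(0,T;U)$ such that for each $1\le j\le n$, $u|_{[t_{j-1},t_j)}=\sum_{k\ge1}I_{\Gamma_{j,k}}u^{j,k}$ (i.e. $u=u^{j,k}$ on $\Gamma_{j,k}$), where $(\Gamma_{j,k})_{k\ge1}\subset\mathcal F_{j-1}$ is a partition of $\Omega$ and $u^{j,k}\in L^0_{\mathcal G_j}(t_{j-1},t_j;U)$. $\mathcal V^\Pi_{0,T}$ is defined in the same way with $V$ and $\mathcal H_j$ in place of $U$ and $\mathcal G_j$. For $0\le t\le t_l\in\Pi$, $\mathcal U^\Pi_{t,t_l}$ and $\mathcal V^\Pi_{t,t_l}$ are the sets of restrictions of these controls to $[t,t_l]$. Dynamics. For $(u,v)\in\mathcal U^\Pi_{t,T}\times\mathcal V^\Pi_{t,T}$, $X^{t,x,u,v}$ is the unique pathwise solution of $X_s=x+\int_t^sf(r,X_r,u_r,v_r)\,dr$, $s\in[t,T]$. NAD-strategies. $\mathcal B^\Pi_{t,t_l}$ is the set of maps $\beta:\mathcal U^\Pi_{t,t_l}\to\mathcal V^\Pi_{t,t_l}$ such that for every $\mathbb F$-stopping time $\tau:\Omega\to\{0,\dots,n-1\}$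 and all $u,u'\in\mathcal U^\Pi_{t,t_l}$ with $u=u'$ $dsdP$-a.s. on $\{(s,\omega):t\le s\le t_{\tau(\omega)}\}$, one has $\beta(u)=\beta(u')$ $dsdP$-a.s. on $\{(s,\omega):t\le s\le t_{\tau(\omega)+1}\}$ (times restricted to $[t,t_l]$). $\mathcal A^\Pi_{t,t_l}$ is the symmetric set of maps $\alpha:\mathcal V^\Pi_{t,t_l}\to\mathcal U^\Pi_{t,t_l}$. For every $(\alpha,\beta)\in\mathcal A^\Pi_{t,t_l}\times\mathcal B^\Pi_{t,t_l}$ there is a $dsdP$-a.s. unique $(u,v)\in\mathcal U^\Pi_{t,t_l}\times\mathcal V^\Pi_{t,t_l}$ with $\alpha(v)=u$, $\beta(u)=v$; one sets $X^{t,x,\alpha,\beta}:=X^{t,x,u,v}$. Value functions along $\Pi$. For $t_i\le t<t_{i+1}$ ($0\le i\le n-1$), $$V^\Pi(t,x)=\operatorname{esssup}_{\alpha\in\mathcal A^\Pi_{t,T}}\operatorname{essinf}_{\beta\in\mathcal B^\Pi_{t,T}}E[g(X_T^{t,x,\alpha,\beta})|\mathcal F_i],\quad U^\Pi(t,x)=\operatorname{essinf}_{\beta\in\mathcal B^\Pi_{t,T}}\operatorname{esssup}_{\alpha\in\mathcal A^\Pi_{t,T}}E[g(X_T^{t,x,\alpha,\beta})|\mathcal F_i],$$ and $V^\Pi(T,x)=U^\Pi(T,x)=g(x)$. These random variables are $P$-a.s. constant and are identified with the deterministic functions $V^\Pi(t,x):=E[V^\Pi(t,x)]$, $U^\Pi(t,x):=E[U^\Pi(t,x)]$.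 *)

(* Defs.v *)
From HB Require Import structures.
From mathcomp Require Import all_boot all_order all_algebra.
From mathcomp Require Import all_classical all_reals all_analysis.
From mathcomp Require Import measurable_realfun.

Set Implicit Arguments.
Unset Strict Implicit.
Unset Printing Implicit Defensive.

Import Order.TTheory GRing.Theory Num.Theory.
Import numFieldNormedType.Exports.

Local Open Scope classical_set_scope.
Local Open Scope ring_scope.

(* Nonempty metric spaces; the point also serves as the value of a process
   outside the time interval on which it lives. *)
#[short(type="pmetricType")]
HB.structure Definition PointedMetric (R : numDomainType) :=
  {M of Metric R M & isPointed M}.

Definition borel (E : ptopologicalType) := g_sigma_algebraType (@open E).

(** The probability space *)

Definition unit_itv (R : realType) : Type := {r : R | 0 <= r <= 1}.

Section unit_itv.
Variable R : realType.

HB.instance Definition _ := Choice.on (unit_itv R).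

Fact unit_itv0_subproof : 0 <= (0 : R) <= 1.
Proof. by rewrite lexx ler01. Qed.

HB.instance Definition _ :=
  isPointed.Build (unit_itv R) (exist _ 0 unit_itv0_subproof).

End unit_itv.

Definition unit_val (R : realType) : unit_itv R -> R := sval.

(* [0, 1] with its Borel sigma-algebra, the trace of the one of R *)
Definition I01 (R : realType) := g_sigma_algebra_preimageType (@unit_val R).

(* The j-th coordinate map for j >= 1 (meaningless for j = 0): nat numbers the
   coordinates of a sequence from 0. *)
Definition zeta (R : realType) (j : nat) (w : nat -> I01 R * I01 R) :=
  w j.-1.

Definition Omega (R : realType) :=
  g_sigma_algebraType (\bigcup_(j in [set j | (0 < j)%N])
    preimage_set_system setT (@zeta R j) measurable).

Definition lambda2 (R : realType) (A : set (I01 R * I01 R)) : \bar R :=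
  ((@lebesgue_measure R) \x (@lebesgue_measure R))%E
    [set (unit_val z.1, unit_val z.2) | z in A].

(* P is the infinite product of copies of lambda2; this determines P. *)
Definition is_product_law (R : realType) (P : probability (Omega R) R) :=
  forall (n : nat) (A : nat -> set (I01 R * I01 R)),
    (forall j, measurable (A j)) ->
    P [set w | forall j, (0 < j <= n)%N -> A j (zeta j w)]
    = (\prod_(1 <= j < n.+1) fine (lambda2 (A j)))%:E.

Section sigma_fields.
Variable R : realType.

Definition calG (j : nat) : set (set (Omega R)) :=
  preimage_set_system setT (fun w => (zeta j w).1) measurable.

Definition calH (j : nat) : set (set (Omega R)) :=
  preimage_set_system setT (fun w => (zeta j w).2) measurable.

Definition calF (j : nat) : set (set (Omega R)) :=
  <<s \bigcup_(i in [set i | (0 < i <= j)%N])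
        preimage_set_system setT (@zeta R i) measurable >>.

Definition stopping_time (tau : Omega R -> nat) :=
  forall j, calF j (tau @^-1` [set j]).

End sigma_fields.

Definition dsdP (R : realType) (P : probability (Omega R) R) :
    {measure set (measurableTypeR R * Omega R) -> \bar R} :=
  (@lebesgue_measure R \x P)%E.

(** Controls and strategies along a partition 0 < t_1 < ... < t_n = T, given
    by the sequence s = [:: t_1; ...; t_n] with [itv_partition 0 T s] *)

Definition tpt (R : realType) (s : seq R) (i : nat) : R := nth 0 (0 :: s) i.

(* the i such that t_i <= t < t_(i+1), see [stageP] *)
Definition stage (R : realType) (s : seq R) (t : R) : nat :=
  find (fun r => t < r) s.

Lemma stageP (R : realType) (T : R) (s : seq R) (t : R) :
  itv_partition 0 T s -> 0 <= t < T ->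
  (stage s t < size s)%N /\ tpt s (stage s t) <= t < tpt s (stage s t).+1.
Proof.
move=> [_ /eqP lastT] /andP[t0 tT]; rewrite /stage.
have hs : has (fun r => t < r) s.
  apply/hasP; exists T => //; case: s lastT => [/= E|a s /= <-].
    by move: tT; rewrite -E ltNge t0.
  exact: mem_last.
split; first by rewrite -has_find.
apply/andP; split; last by rewrite /tpt /=; exact: (nth_find 0 hs).
case E : (find _ s) => [//|k]; rewrite /tpt /= leNgt.
by apply/negbT/(@before_find _ 0 (fun r => t < r)); rewrite E.
Qed.

Definition process (R : realType) (E : Type) := R -> Omega R -> E.

Section controls.
Variables (R : realType) (E : pmetricType R).

Definition L0 (K : set (set (Omega R))) (a b : R) : set (process R E) :=
  [set u | measurable_fun (`[a, b] `*` setT)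
             (fun z : measurableTypeR R * Omega R => u z.1 z.2 : borel E) /\
           forall r, a <= r <= b ->
             preimage_set_system setT (u r : Omega R -> borel E) measurable
             `<=` K].

(* controls on [0, T]; K is calG or calH *)
Definition controls0 (K : nat -> set (set (Omega R))) (T : R) (s : seq R) :
    set (process R E) :=
  [set u | L0 measurable 0 T u /\
    forall j, (0 < j <= size s)%N ->
      exists (Gamma : nat -> set (Omega R)) (v : nat -> process R E),
        [/\ forall k, calF j.-1 (Gamma k),
            trivIset setT Gamma,
            \bigcup_k Gamma k = setT,
            forall k, L0 (K j) (tpt s j.-1) (tpt s j) (v k) &
            forall k r w, tpt s j.-1 <= r < tpt s j -> Gamma k w ->
              u r w = v k r w]].

(* Restrictions to [t, t']: processes are total functions, which [\_] sets to
   the default value outside [t, t'], so that equal restrictions are equal. *)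
Definition controls (K : nat -> set (set (Omega R))) (T : R) (s : seq R)
    (t t' : R) : set (process R E) :=
  [set (u \_ `[t, t'] : process R E) | u in controls0 K T s].

End controls.

(* A strategy is a map from A to B; its values outside A are irrelevant. *)
Definition nad_strategies (R : realType) (E E' : Type)
    (P : probability (Omega R) R) (s : seq R) (t t' : R)
    (A : set (process R E)) (B : set (process R E')) :
    set (process R E -> process R E') :=
  [set beta | set_fun A B beta /\
    forall tau : Omega R -> nat,
      stopping_time tau -> (forall w, (tau w < size s)%N) ->
      forall u u', A u -> A u' ->
      {ae dsdP P, forall z : measurableTypeR R * Omega R,
         t <= z.1 <= tpt s (tau z.2) -> z.1 <= t' -> u z.1 z.2 = u' z.1 z.2} ->
      {ae dsdP P, forall z : measurableTypeR R * Omega R,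
         t <= z.1 <= tpt s (tau z.2).+1 -> z.1 <= t' ->
         beta u z.1 z.2 = beta u' z.1 z.2}].

(** Dynamics *)

Section dynamics.
Variables (R : realType) (d : nat) (U V : Type).
Variable f : R -> 'rV[R]_d -> U -> V -> 'rV[R]_d.

Definition is_trajectory (T t : R) (x : 'rV[R]_d) (u : R -> U) (v : R -> V)
    (X : R -> 'rV[R]_d) :=
  {within `[t, T], continuous X} /\
  forall r, t <= r <= T -> forall i,
    X r 0 i = x 0 i +
      \int[@lebesgue_measure R]_(q in `[t, r]) (f q (X q) (u q) (v q)) 0 i.

Definition trajectory T t x u v : R -> 'rV[R]_d :=
  get [set X | is_trajectory T t x u v X].

End dynamics.

(** Conditional expectations, essential suprema and infima of families; as
    usual they are chosen versions, unique up to P-null sets. *)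

Section versions.
Context {dsp} {W : measurableType dsp} {R : realType}.
Variable P : probability W R.

Definition is_cond_exp (K : set (set W)) (Y Z : W -> R) :=
  [/\ preimage_set_system setT (Z : W -> R) measurable `<=` K,
      P.-integrable setT (EFin \o Z) &
      forall A, K A ->
        (\int[P]_(w in A) (Z w)%:E = \int[P]_(w in A) (Y w)%:E)%E].

Definition cond_exp (K : set (set W)) (Y : W -> R) : W -> R :=
  get [set Z | is_cond_exp K Y Z].

Definition is_esssup (I : Type) (A : set I) (Y : I -> W -> \bar R)
    (eta : W -> \bar R) :=
  [/\ measurable_fun setT eta,
      forall i, A i -> {ae P, forall w, (Y i w <= eta w)%E} &
      forall eta' : W -> \bar R, measurable_fun setT eta' ->
        (forall i, A i -> {ae P, forall w, (Y i w <= eta' w)%E}) ->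
        {ae P, forall w, (eta w <= eta' w)%E}].

Definition is_essinf (I : Type) (A : set I) (Y : I -> W -> \bar R)
    (eta : W -> \bar R) :=
  [/\ measurable_fun setT eta,
      forall i, A i -> {ae P, forall w, (eta w <= Y i w)%E} &
      forall eta' : W -> \bar R, measurable_fun setT eta' ->
        (forall i, A i -> {ae P, forall w, (eta' w <= Y i w)%E}) ->
        {ae P, forall w, (eta' w <= eta w)%E}].

Definition esssup (I : Type) (A : set I) (Y : I -> W -> \bar R) :
  W -> \bar R := get [set eta | is_esssup A Y eta].

Definition essinf (I : Type) (A : set I) (Y : I -> W -> \bar R) :
  W -> \bar R := get [set eta | is_essinf A Y eta].

End versions.

(** The game *)

Section game.
Variables (R : realType) (d : nat) (U V : pmetricType R).
Variable f : R -> 'rV[R]_d -> U -> V -> 'rV[R]_d.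
Variable g : 'rV[R]_d -> R.
Variable P : probability (Omega R) R.
Variables (T : R) (s : seq R).

Definition calU (t t' : R) : set (process R U) := controls (@calG R) T s t t'.

Definition calV (t t' : R) : set (process R V) := controls (@calH R) T s t t'.

Definition calA (t t' : R) : set (process R V -> process R U) :=
  nad_strategies P s t t' (calV t t') (calU t t').

Definition calB (t t' : R) : set (process R U -> process R V) :=
  nad_strategies P s t t' (calU t t') (calV t t').

(* alpha(v) = u and beta(u) = v hold up to dsdP-null sets, processes being
   identified when they agree almost everywhere. *)
Definition is_outcome (t t' : R) (alpha : process R V -> process R U)
    (beta : process R U -> process R V) (uv : process R U * process R V) :=
  [/\ calU t t' uv.1, calV t t' uv.2,
      {ae dsdP P, forall z : measurableTypeR R * Omega R,
         t <= z.1 <= t' -> alpha uv.2 z.1 z.2 = uv.1 z.1 z.2} &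
      {ae dsdP P, forall z : measurableTypeR R * Omega R,
         t <= z.1 <= t' -> beta uv.1 z.1 z.2 = uv.2 z.1 z.2}].

Definition outcome t t' alpha beta : process R U * process R V :=
  get [set uv | is_outcome t t' alpha beta uv].

Definition state (t : R) (x : 'rV[R]_d) alpha beta (r : R) (w : Omega R) :
    'rV[R]_d :=
  let uv := outcome t T alpha beta in
  trajectory f T t x (uv.1 ^~ w) (uv.2 ^~ w) r.

Definition payoff (t : R) (x : 'rV[R]_d) alpha beta (w : Omega R) : R :=
  g (state t x alpha beta T w).

Definition lower_rv (t : R) (x : 'rV[R]_d) : Omega R -> \bar R :=
  esssup P (calA t T) (fun alpha =>
    essinf P (calB t T) (fun beta =>
      EFin \o cond_exp P (calF (stage s t)) (payoff t x alpha beta))).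

Definition upper_rv (t : R) (x : 'rV[R]_d) : Omega R -> \bar R :=
  essinf P (calB t T) (fun beta =>
    esssup P (calA t T) (fun alpha =>
      EFin \o cond_exp P (calF (stage s t)) (payoff t x alpha beta))).

Definition lower_value (t : R) (x : 'rV[R]_d) : \bar R :=
  if t == T then (g x)%:E else (\int[P]_w lower_rv t x w)%E.

Definition upper_value (t : R) (x : 'rV[R]_d) : \bar R :=
  if t == T then (g x)%:E else (\int[P]_w upper_rv t x w)%E.

End game.

(* Main.v *)
Require Import Defs.
From HB Require Import structures.
From mathcomp Require Import all_boot all_order all_algebra.
From mathcomp Require Import all_classical all_reals all_analysis.
From mathcomp Require Import measurable_realfun.
From mathcomp Require Import ring lra.

Set Implicit Arguments.
Unset Strict Implicit.
Unset Printing Implicit Defensive.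

Import Order.TTheory GRing.Theory Num.Theory.
Import numFieldNormedType.Exports.

Local Open Scope classical_set_scope.
Local Open Scope ring_scope.

(** Let [i] be the stage of [t], so that t_i <= t < t_(i+1), and let F_i be the
    information available at t_i. The lower value is the expectation of
    esssup_alpha essinf_beta E[J(alpha, beta) | F_i], and the point is that
    expectation may be exchanged with both operations.

    For a directed family of bounded random variables this is classical
    ([esssup_directed]): a maximizing sequence of expectations has a supremum
    that dominates every member of the family almost surely. Both families are
    directed because strategies can be pasted along an event D of F_i: playing
    alpha1 on D and alpha2 off D is again an admissible strategy ([nad_paste]),
    as a control on [t, T] may use F_i from its first stage on. What happens on
    D then depends only on the strategies played on D ([outcome_local],
    [payoff_local]): nonanticipation, applied to the stopping time equal to k
    on D and to i off D, lets one follow the two outcomes stage by stage on D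
    alone. Hence, given beta1 and beta2, pasting along the event where the
    first conditional payoff is the smaller one realizes the minimum of both.
    The same argument works one level up, for the essential infima over beta
    indexed by alpha; there the event has to be taken in F_i although an
    essential infimum is only determined up to null sets, which is why
    [essinf_cond_exp] provides an F_i-measurable version. Exchanging twice and
    using E[E[J | F_i]] = E[J] gives sup_alpha inf_beta E[J(alpha, beta)]
    ([esssup_essinf_cond_exp]), and the upper value follows by changing signs
    and exchanging the players.

    For the argument to start, outcomes have to exist and payoffs have to be
    measurable. An outcome is reached by iterating (u, v) |-> (alpha v, beta u),
    since each iteration settles one more stage ([outcomeP]). The payoff is a
    function of the solution at time T of an ordinary differential equation
    whose right-hand side is measurable in time and depends measurably on omega:
    the Picard iterates are jointly measurable and contract in a norm with
    exponential weight ([picard_contraction]), so the solution is measurable,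
    and it does not change when the controls change on a null set of times
    ([ae_eq_trajectory]). The composition f(r, X_r, u_r, v_r) is measurable
    because measurable maps into compact metric spaces are pointwise limits of
    countably valued ones ([measurable_field]). At t = T the payoff is the constant g(x). *)

(** * Essential suprema of directed families *)

Section ae_bounded.
Context {dsp : measure_display} {W : measurableType dsp} {R : realType}.
Variable P : probability W R.
Local Open Scope ereal_scope.

Lemma ae_bounded_integrable (f : W -> \bar R) (M : R) :
  measurable_fun setT f -> {ae P, forall w, `|f w| <= M%:E} ->
  P.-integrable setT f.
Proof.
move=> mf fM.
have cf : {ae P, forall w, setT w -> f w @[_ --> \oo] --> f w}.
  by apply: aeW => w _; exact: cvg_cst.
have bf : {ae P, forall w, forall n : nat, setT w -> `|f w| <= cst M%:E w}.
  by move: fM; apply: filterS.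
have iM : P.-integrable setT (cst M%:E).
  exact: finite_measure_integrable_cst.
by have [] := @dominated_convergence _ _ _ P setT measurableT (fun=> f) f
  (cst M%:E) (fun=> mf) mf cf iM bf.
Qed.

Lemma ae_le_integral_on (D : set W) (f g : W -> \bar R) : measurable D ->
  P.-integrable D f -> P.-integrable D g ->
  {ae P, forall w, D w -> f w <= g w} ->
  \int[P]_(w in D) f w <= \int[P]_(w in D) g w.
Proof.
move=> mD fi gi fg.
have mf := measurable_int _ fi; have mg := measurable_int _ gi.
rewrite (@ae_eq_integral _ _ _ P D (fun w => mine (f w) (g w)) f)//.
- apply: le_integral => //; last by move=> w _; rewrite ge_min lexx orbT.
  apply: (@le_integrable _ _ _ P _ mD _ (fun w => `|f w| + `|g w|)).
  + exact: measurable_mine.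
  + move=> w _ /=; rewrite [leRHS]gee0_abs ?adde_ge0//.
    by have [_|_] := leP (f w) (g w); rewrite ?leeDl ?leeDr.
  + by apply: integrableD => //; exact: integrable_abse.
- exact: measurable_mine.
- by move: fg; apply: filterS => w /= fg Dw; rewrite min_l// fg.
Qed.

Lemma ae_le_integral (f g : W -> \bar R) :
  P.-integrable setT f -> P.-integrable setT g ->
  {ae P, forall w, f w <= g w} -> \int[P]_w f w <= \int[P]_w g w.
Proof.
by move=> fi gi fg; apply: ae_le_integral_on => //; apply: filterS fg => w.
Qed.

(** An integral form of almost sure domination, suited to families closed
    under maxima up to domination: max (f, g) - g is nonnegative and has
    integral 0. *)
Lemma ae_le_of_integral_max (f g : W -> \bar R) (M : R) :
  measurable_fun setT f -> measurable_fun setT g ->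
  {ae P, forall w, `|f w| <= M%:E} -> {ae P, forall w, `|g w| <= M%:E} ->
  \int[P]_w maxe (f w) (g w) <= \int[P]_w g w ->
  {ae P, forall w, f w <= g w}.
Proof.
move=> mf mg fM gM le_int.
pose h w := maxe (f w) (g w) - g w.
have mmax : measurable_fun setT (fun w => maxe (f w) (g w)).
  exact: measurable_maxe.
have mi : P.-integrable setT (fun w => maxe (f w) (g w)).
  apply: (@ae_bounded_integrable _ M) => //.
  by move: fM gM; apply: filterS2 => w ? ?; rewrite maxEle; case: ifP.
have gi : P.-integrable setT g by exact: (ae_bounded_integrable mg gM).
have hi : P.-integrable setT h by exact: integrableB.
have mh : measurable_fun setT h by exact: (measurable_int _ hi).
have gfin : {ae P, forall w, g w \is a fin_num}.
  move: gM; apply: filterS => w gM.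
  by rewrite fin_num_abs (le_lt_trans gM)// ltry.
have h0 : {ae P, forall w, 0 <= h w}.
  move: gfin; apply: filterS => w gfin.
  by rewrite /h sube_ge0 ?gfin ?orbT// le_max lexx orbT.
have int0 : \int[P]_w `|h w| = 0.
  apply/eqP; rewrite eq_le integral_ge0// andbT.
  rewrite (@ae_eq_integral _ _ _ P setT h)//.
  - by rewrite integralB// sube_le0.
  - exact: measurableT_comp.
  - by move: h0; apply: filterS => w h0 _; rewrite gee0_abs.
have /(ae_eq_integral_abs P measurableT mh) hz := int0.
move: hz gfin; apply: filterS2 => w /(_ I) hw gfin.
have : maxe (f w) (g w) <= g w by rewrite -sube_le0 -/(h w) hw.
by rewrite ge_max => /andP[].
Qed.

End ae_bounded.

Section esssup.
Context {dsp : measure_display} {W : measurableType dsp} {R : realType}.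
Variable P : probability W R.
Local Open Scope ereal_scope.

Lemma abse_le (x y : \bar R) : (`|x| <= y) = (- y <= x <= y).
Proof.
case: x y => [x||] [y||] //=; rewrite ?leNye ?leey ?leNey ?andbT ?andbF//.
by rewrite !lee_fin ler_norml.
Qed.

Lemma esssupP (I : Type) (A : set I) (Y : I -> W -> \bar R) eta :
  is_esssup P A Y eta -> is_esssup P A Y (esssup P A Y).
Proof. by move=> h; apply: (@getPex _ (is_esssup P A Y)); exists eta. Qed.

Lemma essinfP (I : Type) (A : set I) (Y : I -> W -> \bar R) eta :
  is_essinf P A Y eta -> is_essinf P A Y (essinf P A Y).
Proof. by move=> h; apply: (@getPex _ (is_essinf P A Y)); exists eta. Qed.

Lemma esssup_unique (I : Type) (A : set I) (Y : I -> W -> \bar R) eta eta' :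
  is_esssup P A Y eta -> is_esssup P A Y eta' -> {ae P, forall w, eta w = eta' w}.
Proof.
move=> [me ue le] [me' ue' le'].
move: (le _ me' ue') (le' _ me ue); apply: filterS2 => w h h'.
by apply/eqP; rewrite eq_le h h'.
Qed.

Lemma is_essinfN (I : Type) (A : set I) (Y : I -> W -> \bar R) eta :
  is_essinf P A Y eta -> is_esssup P A (fun i w => - Y i w) (fun w => - eta w).
Proof.
move=> [me le ge]; split; first exact: measurableT_comp.
  by move=> i /le; apply: filterS => w; rewrite leeN2.
move=> z mz zub; have mNz : measurable_fun setT (fun w => - z w).
  exact: measurableT_comp.
move: (ge _ mNz) => h.
have {h} : {ae P, forall w, - z w <= eta w}.
  by apply: h => i /zub; apply: filterS => w; rewrite leeNl.
by apply: filterS => w; rewrite leeNl.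
Qed.

Lemma is_esssupN (I : Type) (A : set I) (Y : I -> W -> \bar R) eta :
  is_esssup P A Y eta -> is_essinf P A (fun i w => - Y i w) (fun w => - eta w).
Proof.
move=> [me le ge]; split; first exact: measurableT_comp.
  by move=> i /le; apply: filterS => w; rewrite leeN2.
move=> z mz zub; have mNz : measurable_fun setT (fun w => - z w).
  exact: measurableT_comp.
move: (ge _ mNz) => h.
have {h} : {ae P, forall w, eta w <= - z w}.
  by apply: h => i /zub; apply: filterS => w; rewrite leeNr.
by apply: filterS => w; rewrite leeNr.
Qed.

(** The members [i_ n] are chosen with integrals tending to the supremum [c] of
    all integrals. By directedness every finite maximum of members lies below a
    member, so that it has integral at most [c]; by dominated convergence this
    remains true of the maximum of any [Y i] with [eta], and
    [ae_le_of_integral_max] shows that [eta] dominates [Y i]. Writing [eta] as a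
    countable supremum keeps its measurability with respect to any sub-sigma-field
    for which the members are measurable. *)
Lemma esssup_directed (I : Type) (A : set I) (Y : I -> W -> \bar R) (M : R) :
  A !=set0 -> (forall i, A i -> measurable_fun setT (Y i)) ->
  (forall i, A i -> {ae P, forall w, `|Y i w| <= M%:E}) ->
  (forall i j, A i -> A j ->
    exists2 k, A k & {ae P, forall w, maxe (Y i w) (Y j w) <= Y k w}) ->
  exists i_ : nat -> I, let eta w := ereal_sup (range (fun n => Y (i_ n) w)) in
    [/\ forall n, A (i_ n), is_esssup P A Y eta,
        {ae P, forall w, `|eta w| <= M%:E} &
        \int[P]_w eta w = ereal_sup [set \int[P]_w Y i w | i in A]].
Proof.
move=> [i0 Ai0] mY YM dirY.
have Yint i : A i -> P.-integrable setT (Y i).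
  by move=> Ai; exact: (ae_bounded_integrable (mY _ Ai) (YM _ Ai)).
pose c := ereal_sup [set \int[P]_w Y i w | i in A].
have leM i : A i -> \int[P]_w Y i w <= M%:E.
  move=> Ai; have -> : M%:E = \int[P]_w (cst M%:E w).
    rewrite integral_cst// -[LHS]mule1; congr (_ * _).
    exact/esym/probability_setT.
  apply: ae_le_integral => //; first exact: Yint.
    exact: finite_measure_integrable_cst.
  by apply: filterS (YM _ Ai) => w; apply: le_trans; rewrite lee_abs.
have cfin : c \is a fin_num.
  rewrite fin_numE; apply/andP; split.
    rewrite -ltNye (@lt_le_trans _ _ (\int[P]_w Y i0 w))//; last first.
      by apply: ereal_sup_ubound; exists i0.
    by rewrite ltNye_eq (integrable_fin_num _ (Yint _ Ai0)).
  rewrite -ltey (@le_lt_trans _ _ M%:E) ?ltry//.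
  by apply: ge_ereal_sup => _ [i Ai <-]; exact: leM.
have /choice[i_ i_P] (n : nat) :
    exists i, A i /\ c - (n.+1%:R^-1)%:E < \int[P]_w Y i w.
  have [|_ [i Ai <-] ci] := @ub_ereal_sup_adherent _ _ (n.+1%:R^-1 : R) _ cfin.
    by rewrite invr_gt0.
  by exists i.
have Ai_ n : A (i_ n) by case: (i_P n).
pose eta w := ereal_sup (range (fun n => Y (i_ n) w)).
have Yeta n w : Y (i_ n) w <= eta w by apply: ereal_sup_ubound; exists n.
have msup (x : nat -> W -> \bar R) : (forall n, measurable_fun setT (x n)) ->
    measurable_fun setT (fun w => ereal_sup (range (x ^~ w))).
  move=> mx; have := measurable_fun_esups mx 0%N; congr measurable_fun.
  apply/funext => w; rewrite /esups /sdrop; congr ereal_sup.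
  by apply/seteqP; split=> [_ [n _ <-]|_ [n _ <-]]; exists n.
have meta : measurable_fun setT eta by apply: msup => n; exact: mY.
have etaM : {ae P, forall w, `|eta w| <= M%:E}.
  have /ae_foralln : forall n, {ae P, forall w, `|Y (i_ n) w| <= M%:E}.
    by move=> n; exact: YM.
  apply: filterS => w wM; rewrite abse_le; apply/andP; split.
    by rewrite (le_trans _ (Yeta 0%N w))//; have := wM 0%N; rewrite abse_le => /andP[].
  apply: ge_ereal_sup => _ [n _ <-].
  by have := wM n; rewrite abse_le => /andP[].
have etai : P.-integrable setT eta by exact: (ae_bounded_integrable meta etaM).
have c_le : c <= \int[P]_w eta w.
  apply/lee_addgt0Pr => e e0.
  have [n ne] : exists n : nat, (n.+1%:R^-1 < e)%R.
    exact: filter_ex (near_infty_natSinv_lt (PosNum e0)).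
  have [_ /ltW] := i_P n; rewrite leeBlDr// => /le_trans; apply.
  apply: leeD; last by rewrite lee_fin ltW.
  by apply: ae_le_integral => //; [exact: Yint|exact: aeW].
have key i : A i -> \int[P]_w maxe (Y i w) (eta w) <= c.
  move=> Ai.
  (* Running maxima started at [Y i], each almost surely below a member. *)
  pose x := fix x n w := if n is n'.+1 then maxe (x n' w) (Y (i_ n') w) else Y i w.
  have mx n : measurable_fun setT (x n).
    by elim: n => [|n IH]; [exact: mY|apply: measurable_maxe => //; exact: mY].
  have xY n : exists2 k, A k & {ae P, forall w, x n w <= Y k w}.
    elim: n => [|n [k Ak IH]]; first by exists i => //; exact: aeW.
    have [l Al kl] := dirY _ _ Ak (Ai_ n); exists l => //.
    move: IH kl; apply: filterS2 => w h; rewrite /= !ge_max => /andP[h1 ->].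
    by rewrite (le_trans h h1).
  have x_nd w : {homo x^~ w : n m / (n <= m)%N >-> n <= m}.
    by apply: homo_leq => [//|b a d' /le_trans h /h//|n /=]; rewrite le_max lexx.
  have xM n : {ae P, forall w, `|x n w| <= M%:E}.
    elim: n => [|n IH]; first exact: YM.
    move: IH (YM _ (Ai_ n)); apply: filterS2 => w /= h h'.
    by rewrite maxEle; case: ifP.
  pose xs w := ereal_sup (range (x ^~ w)).
  have xub n w : x n w <= xs w by apply: ereal_sup_ubound; exists n.
  have xi n : P.-integrable setT (x n) by exact: (ae_bounded_integrable (mx n) (xM n)).
  have xc n : \int[P]_w x n w <= c.
    have [k Ak xk] := xY n; apply: (@le_trans _ _ (\int[P]_w Y k w)).
      by apply: ae_le_integral => //; exact: Yint.
    by apply: ereal_sup_ubound; exists k.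
  have cf : {ae P, forall w, setT w -> x ^~ w @ \oo --> xs w}.
    by apply: aeW => w _; exact: ereal_nondecreasing_cvgn.
  have bf : {ae P, forall w, forall n, setT w -> `|x n w| <= cst M%:E w}.
    by have /ae_foralln := xM; apply: filterS => w h n _; exact: h.
  have iM : P.-integrable setT (cst M%:E).
    exact: finite_measure_integrable_cst.
  have [xsi _ xscvg] := @dominated_convergence _ _ _ P setT measurableT x xs
    (cst M%:E) mx (msup _ mx) cf iM bf.
  apply: (@le_trans _ _ (\int[P]_w xs w)).
    apply: ae_le_integral => //.
      apply: (@ae_bounded_integrable _ _ _ _ _ M).
        by apply: measurable_maxe => //; exact: mY.
      move: (YM _ Ai) etaM; apply: filterS2 => w /= h h'.
      by rewrite maxEle; case: ifP.
    apply: aeW => w /=; rewrite ge_max (xub 0%N w)/=.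
    apply: ge_ereal_sup => _ [n _ <-]; apply: le_trans (xub n.+1 w).
    by rewrite /= le_max lexx orbT.
  rewrite -(cvg_lim _ xscvg)//; apply: lime_le; first exact: cvgP xscvg.
  by apply: nearW => n; exact: xc.
have eta_c : \int[P]_w eta w = c.
  apply/eqP; rewrite eq_le c_le andbT (le_trans _ (key _ Ai0))//.
  apply: ae_le_integral => //.
    apply: (@ae_bounded_integrable _ _ _ _ _ M).
      by apply: measurable_maxe => //; exact: mY.
    move: (YM _ Ai0) etaM; apply: filterS2 => w /= h h'.
    by rewrite maxEle; case: ifP.
  by apply: aeW => w /=; rewrite le_max lexx orbT.
exists i_; split => //; split => //.
- move=> i Ai; apply: (@ae_le_of_integral_max _ _ _ _ _ _ M) => //.
  + exact: mY.
  + exact: YM.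
  + by rewrite eta_c; exact: key.
- move=> z mz zub; have /ae_foralln : forall n, {ae P, forall w, Y (i_ n) w <= z w}.
    by move=> n; exact: zub.
  by apply: filterS => w h; apply: ge_ereal_sup => _ [n _ <-].
Qed.

End esssup.

(** * Conditional expectation *)

Section cond_exp.
Context {dsp : measure_display} {W : measurableType dsp} {R : realType}.
Variables (P : probability W R) (K : set (set W)).
Hypothesis sK : sigma_algebra setT K.
Hypothesis Km : K `<=` measurable.
Local Open Scope ereal_scope.

Let KT := g_sigma_algebraType K.

Let mKT : (measurable : set (set KT)) = K.
Proof. exact: sigma_algebra_id. Qed.

Let idK : W -> KT := id.

Let m_idK : measurable_fun setT idK.
Proof. by move=> _ B; rewrite mKT => /Km mB; rewrite setTI. Qed.

HB.instance Definition _ := isMeasurableFun.Build _ _ _ _ idK m_idK.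

(** The conditional expectation is the Radon-Nikodym derivative, on [K], of the
    charge A |-> E[Y; A] with respect to [P]. *)
Lemma cond_expP (Y : W -> R) : P.-integrable setT (EFin \o Y) ->
  is_cond_exp P K Y (cond_exp P K Y).
Proof.
move=> iY; rewrite /cond_exp; set S := [set Z | _]; apply: (@getPex _ S).
pose nu0 := induced_charge iY : {charge set W -> \bar R}.
(* The charge structure of an image requires a proof that the map is measurable,
   which unification cannot find. *)
pose nu : {charge set KT -> \bar R} :=
  @measure_function_pushforward__canonical__charge_Charge _ _ _ _ idK R nu0 m_idK.
pose mu : probability KT R := distribution P idK.
have nu_mu : nu `<< mu.
  apply: (@dominates_pushforward _ _ W KT R P nu0 idK m_idK).
  apply/null_content_dominatesP => A mA PA; apply: null_set_integral => //.
  by apply: measurable_funS (measurable_int _ iY).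
pose Z := Radon_Nikodym nu mu.
have Zfin w : Z w \is a fin_num by exact: Radon_Nikodym_fin_num.
have iZ : mu.-integrable setT Z by exact: Radon_Nikodym_integrable.
have mZ : measurable_fun setT Z by exact: (measurable_int _ iZ).
have fineZ : EFin \o (fine \o Z) = Z.
  by apply/funext => w /=; rewrite fineK.
have iZP : P.-integrable setT (Z \o idK).
  apply/integrableP; split; first exact: measurableT_comp mZ m_idK.
  move/integrableP : iZ => [_]; rewrite /mu /distribution.
  by rewrite ge0_integral_pushforward//; exact: measurableT_comp.
exists (fine \o Z); split.
- move=> _ [B mB <-]; rewrite -mKT.
  by apply: (measurableT_comp _ mZ) => //; exact: fine_measurable.
- by rewrite fineZ.
- move=> A KA; rewrite -[LHS]/(\int[P]_(w in A) (EFin \o (fine \o Z)) w) fineZ.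
  have mA : measurable (A : set KT) by rewrite mKT.
  transitivity (\int[mu]_(w in A) Z w); last first.
    by rewrite -(Radon_Nikodym_integral nu_mu mA).
  rewrite /mu /distribution (integral_pushforward m_idK)//.
  by apply: integrableS iZP => //; exact: Km.
Qed.

(** Conditional expectations are compared locally on an event [A] of [K]: on
    the part of [A] where the order fails, which again belongs to [K], the
    integrals of [Z] and [Z'] are those of [Y] and [Y']. *)
Lemma cond_exp_le_on (Y Y' Z Z' : W -> R) (A : set W) :
  P.-integrable setT (EFin \o Y) -> P.-integrable setT (EFin \o Y') ->
  is_cond_exp P K Y Z -> is_cond_exp P K Y' Z' -> K A ->
  {ae P, forall w, A w -> (Y w <= Y' w)%R} ->
  {ae P, forall w, A w -> (Z w <= Z' w)%R}.
Proof.
move=> iY iY' [KZ iZ ZE] [KZ' iZ' ZE'] KA YY'.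
have mZ : measurable_fun setT (Z : KT -> R).
  by move=> _ B mB; rewrite mKT; apply: KZ; exists B.
have mZ' : measurable_fun setT (Z' : KT -> R).
  by move=> _ B mB; rewrite mKT; apply: KZ'; exists B.
have mA : measurable (A : set KT) by rewrite mKT.
pose B := A `&` [set w | (Z' w < Z w)%R].
have KB : K B.
  rewrite -mKT; apply: measurableI => //.
  have /(_ measurableT [set true]) := measurable_fun_ltr mZ' mZ.
  by rewrite setTI; apply.
have mB := Km KB.
have iB f : P.-integrable setT f -> P.-integrable B f.
  by move=> /integrableS; apply.
have intB : \int[P]_(w in B) (Z w)%:E <= \int[P]_(w in B) (Z' w)%:E.
  rewrite ZE// ZE'//; apply: ae_le_integral_on => //; [exact: iB|exact: iB|].
  by apply: filterS YY' => w h [Aw _]; rewrite lee_fin h.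
have : \int[P]_(w in B) `|(Z w - Z' w)%:E| = 0.
  apply/eqP; rewrite eq_le integral_ge0// andbT.
  rewrite (@eq_integral _ _ _ P B (fun w => (Z w)%:E - (Z' w)%:E)).
    by rewrite integralB//; [rewrite sube_le0|exact: iB|exact: iB].
  move=> w /set_mem[_ /= /ltW h] /=.
  by rewrite ger0_norm ?subr_ge0.
have mZZ' : measurable_fun B (fun w => (Z w - Z' w)%:E).
  have := measurable_int _ (integrableB mB (iB _ iZ) (iB _ iZ')).
  by congr measurable_fun.
move=> /(ae_eq_integral_abs P mB mZZ'); apply: filterS => w h Aw.
rewrite leNgt; apply/negP => ltZ.
have /= [] := h (conj Aw ltZ).
by move/eqP; rewrite subr_eq0 gt_eqF.
Qed.

Let KsetT : K setT.
Proof. by case: sK => K0 KD _; rewrite -(setD0 setT); exact: KD. Qed.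

Let KC D : K D -> K (~` D).
Proof. by case: sK => _ KD _; rewrite -setTD; exact: KD. Qed.

(** Stability under the choice, on an event of [K], of one member or another
    of the family: this is what makes conditional expectations given [K]
    directed. *)
Definition pastable (I : Type) (A : set I) (Y : I -> W -> R) :=
  forall D i1 i2, K D -> A i1 -> A i2 -> exists2 i, A i &
    {ae P, forall w, D w -> Y i w = Y i1 w} /\
    {ae P, forall w, ~ D w -> Y i w = Y i2 w}.

Lemma cond_exp_measurable (Y Z : W -> R) :
  is_cond_exp P K Y Z -> measurable_fun setT (Z : KT -> R).
Proof. by move=> [KZ _ _] _ B mB; rewrite mKT; apply: KZ; exists B. Qed.

Lemma cond_exp_eq_on (Y Y' Z Z' : W -> R) (D : set W) :
  P.-integrable setT (EFin \o Y) -> P.-integrable setT (EFin \o Y') ->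
  is_cond_exp P K Y Z -> is_cond_exp P K Y' Z' -> K D ->
  {ae P, forall w, D w -> Y w = Y' w} -> {ae P, forall w, D w -> Z w = Z' w}.
Proof.
move=> iY iY' YZ YZ' KD YY'.
have h1 : {ae P, forall w, D w -> (Z w <= Z' w)%R}.
  apply: (cond_exp_le_on iY iY') => //.
  by apply: filterS YY' => w h /h ->.
have h2 : {ae P, forall w, D w -> (Z' w <= Z w)%R}.
  apply: (cond_exp_le_on iY' iY) => //.
  by apply: filterS YY' => w h /h ->.
by move: h1 h2; apply: filterS2 => w h1 h2 Dw; apply/eqP; rewrite eq_le h1// h2.
Qed.

Lemma cond_exp_bounded (Y Z : W -> R) (M : R) :
  P.-integrable setT (EFin \o Y) -> is_cond_exp P K Y Z ->
  {ae P, forall w, (`|Y w| <= M)%R} -> {ae P, forall w, `|(Z w)%:E| <= M%:E}.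
Proof.
move=> iY YZ YM.
have cc (r : R) : is_cond_exp P K (cst r) (cst r).
  split => //; last by apply: finite_measure_integrable_cst.
  move=> _ [B mB <-]; rewrite -mKT.
  by apply: (@measurable_cst _ _ KT _ setT r) => //; rewrite mKT.
have ic r : P.-integrable setT (EFin \o cst r).
  exact: finite_measure_integrable_cst.
have h1 : {ae P, forall w, setT w -> (Z w <= M)%R}.
  apply: (cond_exp_le_on iY (ic M) YZ (cc M)) => //.
  by apply: filterS YM => w; rewrite ler_norml => /andP[].
have h2 : {ae P, forall w, setT w -> (- M <= Z w)%R}.
  apply: (cond_exp_le_on (ic (- M)%R) iY (cc (- M)%R) YZ) => //.
  by apply: filterS YM => w; rewrite ler_norml => /andP[].
move: h1 h2; apply: filterS2 => w h1 h2.
by rewrite lee_fin ler_norml h1// h2.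
Qed.

(** The conditional expectations are directed downwards: pasting along the
    event where [Z b1] < [Z b2] realizes the minimum of both. The version [eta]
    is measurable for [K] because it is a countable infimum. *)
Lemma essinf_cond_exp (J : Type) (B : set J) (p Z : J -> W -> R) (M : R) :
  B !=set0 -> (forall b, B b -> P.-integrable setT (EFin \o p b)) ->
  (forall b, B b -> {ae P, forall w, (`|p b w| <= M)%R}) ->
  (forall b, B b -> is_cond_exp P K (p b) (Z b)) ->
  pastable B p ->
  exists eta : W -> \bar R, [/\ measurable_fun setT (eta : KT -> \bar R),
    is_essinf P B (fun b => EFin \o Z b) eta,
    {ae P, forall w, `|eta w| <= M%:E} &
    \int[P]_w eta w = ereal_inf [set \int[P]_w (p b w)%:E | b in B]].
Proof.
move=> B0 ip pM pZ pasteB.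
pose Y b w := - (Z b w)%:E.
have mZK b : B b -> measurable_fun setT (Z b : KT -> R).
  by move=> /pZ /cond_exp_measurable.
have iZ b : B b -> P.-integrable setT (EFin \o Z b) by move=> /pZ[].
have ZM b : B b -> {ae P, forall w, `|(Z b w)%:E| <= M%:E}.
  by move=> Bb; apply: (cond_exp_bounded (ip _ Bb) (pZ _ Bb)); exact: pM.
have [||||b_ [Bb_ eta_sup etaM etaE]] := @esssup_directed _ _ _ P J B Y M.
- exact: B0.
- by move=> b Bb; apply: measurableT_comp => //; exact: (measurable_int _ (iZ _ Bb)).
- by move=> b /ZM; apply: filterS => w; rewrite abseN.
- move=> b1 b2 Bb1 Bb2; pose D : set W := [set w | (Z b1 w < Z b2 w)%R].
  have KD : K D.
    rewrite -mKT; have /(_ measurableT [set true]) :=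
      measurable_fun_ltr (mZK _ Bb1) (mZK _ Bb2).
    by rewrite setTI; apply.
  have [b3 Bb3 [h1 h2]] := pasteB D b1 b2 KD Bb1 Bb2.
  have KDC := KC KD.
  exists b3 => //.
  have := cond_exp_eq_on (ip _ Bb3) (ip _ Bb1) (pZ _ Bb3) (pZ _ Bb1) KD h1.
  have := cond_exp_eq_on (ip _ Bb3) (ip _ Bb2) (pZ _ Bb3) (pZ _ Bb2) KDC h2.
  apply: filterS2 => w hD hDC; rewrite /Y ge_max !leeN2 !lee_fin.
  have [lt12|le21] := ltP (Z b1 w) (Z b2 w).
    by rewrite hDC// lexx ltW.
  by rewrite hD ?lexx ?le21//; apply/negP; rewrite -leNgt.
move: eta_sup etaM etaE; set eta := (fun w => ereal_sup _) => eta_sup etaM etaE.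
exists (fun w => - eta w); split.
- suff meta : measurable_fun setT (eta : KT -> \bar R).
    exact: (measurableT_comp (@oppe_measurable R setT) meta).
  rewrite (_ : eta = fun w : KT => esups (fun n => Y (b_ n) w) 0%N); last first.
    apply/funext => w; rewrite /esups /sdrop /eta; congr ereal_sup.
    by apply/seteqP; split=> [_ [n _ <-]|_ [n _ <-]]; exists n.
  apply: (@measurable_fun_esups _ KT R setT (fun n w => Y (b_ n) w)) => n.
  have mZn : measurable_fun setT (EFin \o (Z (b_ n) : KT -> R)).
    by apply/measurable_EFinP; apply: mZK.
  exact: (measurableT_comp (@oppe_measurable R setT) mZn).
- have := is_esssupN eta_sup.
  by congr is_essinf; apply/funext => b; apply/funext => w; rewrite /Y oppeK.
- by apply: filterS etaM => w; rewrite abseN.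
- have ieta : P.-integrable setT eta.
    by case: eta_sup => meta _ _; exact: ae_bounded_integrable etaM.
  rewrite integralN; last by rewrite integrable_add_def.
  rewrite etaE -ereal_infN image_comp; congr ereal_inf; apply: eq_imagel => b Bb /=.
  have -> : \int[P]_w (p b w)%:E = \int[P]_w (Z b w)%:E.
    by case: (pZ _ Bb) => _ _ ->.
  rewrite /Y integralN ?oppeK// integrable_add_def//; exact: iZ.
Qed.

(** The essential infima [V a] are directed upwards. Comparing
    [K]-measurable versions of [V a1] and [V a2] gives an event [D] of [K], and
    for the [a3] pasted along [D] the maximum of [V a1] and [V a2] is a lower
    bound of all [Z a3 b], hence lies below [V a3]. *)
Lemma esssup_essinf_cond_exp (I J : Type) (A : set I) (B : set J)
    (p Z : I -> J -> W -> R) (V : I -> W -> \bar R) (M : R) :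
  A !=set0 -> B !=set0 ->
  (forall a b, A a -> B b -> P.-integrable setT (EFin \o p a b)) ->
  (forall a b, A a -> B b -> {ae P, forall w, (`|p a b w| <= M)%R}) ->
  (forall a b, A a -> B b -> is_cond_exp P K (p a b) (Z a b)) ->
  (forall a, A a -> pastable B (p a)) ->
  (forall D a1 a2, K D -> A a1 -> A a2 -> exists2 a3, A a3 & forall b, B b ->
    {ae P, forall w, D w -> p a3 b w = p a1 b w} /\
    {ae P, forall w, ~ D w -> p a3 b w = p a2 b w}) ->
  (forall a, A a -> is_essinf P B (fun b => EFin \o Z a b) (V a)) ->
  exists eta : W -> \bar R, [/\ is_esssup P A V eta,
    P.-integrable setT eta &
    \int[P]_w eta w = ereal_sup [set ereal_inf [set \int[P]_w (p a b w)%:E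
                                               | b in B] | a in A]].
Proof.
move=> A0 B0 ip pM pZ pasteB pasteA Vinf.
have mV a : A a -> measurable_fun setT (V a) by move=> /Vinf[].
have version a : A a -> exists eta : W -> \bar R,
    [/\ measurable_fun setT (eta : KT -> \bar R),
        {ae P, forall w, V a w = eta w},
        {ae P, forall w, `|V a w| <= M%:E} &
        \int[P]_w V a w = ereal_inf [set \int[P]_w (p a b w)%:E | b in B]].
  move=> Aa.
  have [eta [meta inf_eta etaM etaE]] := essinf_cond_exp B0
    (fun b => ip a b Aa) (fun b => pM a b Aa) (fun b => pZ a b Aa) (pasteB a Aa).
  have Veta : {ae P, forall w, V a w = eta w}.
    have := esssup_unique (is_essinfN (Vinf _ Aa)) (is_essinfN inf_eta).
    by apply: filterS => w /oppe_inj.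
  exists eta; split => //.
    by move: Veta etaM; apply: filterS2 => w ->.
  rewrite -etaE; apply: ae_eq_integral => //.
  - exact: mV.
  - by case: inf_eta.
  - by apply: filterS Veta => w h _.
have VM a : A a -> {ae P, forall w, `|V a w| <= M%:E} by move=> /version[? []].
have [||||a_ [_ Vsup VsupM VsupE]] := @esssup_directed _ _ _ P I A V M.
- exact: A0.
- exact: mV.
- exact: VM.
- move=> a1 a2 Aa1 Aa2.
  have [eta1 [meta1 V1 _ _]] := version _ Aa1.
  have [eta2 [meta2 V2 _ _]] := version _ Aa2.
  pose D : set W := [set w | eta2 w <= eta1 w].
  have KD : K D.
    by rewrite -mKT; have := measurable_lee (@measurableT _ KT) meta2 meta1; rewrite setTI.
  have KDC := KC KD.
  have [a3 Aa3 h3] := pasteA D a1 a2 KD Aa1 Aa2; exists a3 => //.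
  have [_ _ glb] := Vinf _ Aa3.
  apply: glb; first by apply: measurable_maxe; exact: mV.
  move=> b Bb; have [hD hDC] := h3 b Bb.
  have Z1 := cond_exp_eq_on (ip _ _ Aa3 Bb) (ip _ _ Aa1 Bb) (pZ _ _ Aa3 Bb)
    (pZ _ _ Aa1 Bb) KD hD.
  have Z2 := cond_exp_eq_on (ip _ _ Aa3 Bb) (ip _ _ Aa2 Bb) (pZ _ _ Aa3 Bb)
    (pZ _ _ Aa2 Bb) KDC hDC.
  have [_ /(_ b Bb) lb1 _] := Vinf _ Aa1.
  have [_ /(_ b Bb) lb2 _] := Vinf _ Aa2.
  have E12 : {ae P, forall w, V a1 w = eta1 w /\ V a2 w = eta2 w}.
    by move: V1 V2; apply: filterS2.
  have lb12 : {ae P, forall w, V a1 w <= (Z a1 b w)%:E /\ V a2 w <= (Z a2 b w)%:E}.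
    by move: lb1 lb2; apply: filterS2.
  have Z12 : {ae P, forall w, (D w -> Z a3 b w = Z a1 b w) /\
      (~ D w -> Z a3 b w = Z a2 b w)}.
    by move: Z1 Z2; apply: filterS2.
  move: E12 lb12 Z12; apply: filterS3 => w [E1 E2] [l1 l2] [hz1 hz2] /=.
  have [le21|lt12] := leP (eta2 w) (eta1 w).
    by rewrite max_l ?E1 ?E2// hz1// -E1.
  rewrite max_r ?E1 ?E2 ?(ltW lt12)// hz2 -?E2//.
  by apply/negP; rewrite -ltNge.
exists (fun w => ereal_sup [set V (a_ i) w | i in setT]); split => //.
  by case: Vsup => mVs _ _; exact: ae_bounded_integrable VsupM.
rewrite VsupE; congr ereal_sup; apply: eq_imagel => a Aa.
by have [? []] := version _ Aa.
Qed.

Lemma is_cond_expN (Y Z : W -> R) : P.-integrable setT (EFin \o Y) ->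
  is_cond_exp P K Y Z ->
  is_cond_exp P K (fun w => (- Y w)%R) (fun w => (- Z w)%R).
Proof.
move=> iY YZ; have mZ := cond_exp_measurable YZ; have [KZ iZ ZE] := YZ; split.
- move=> _ [C mC <-]; rewrite -mKT.
  have mN : measurable_fun setT (fun w : KT => - Z w)%R by exact: measurableT_comp.
  exact: mN.
- exact: integrableN iZ.
- move=> D KD; have mD := Km KD.
  have iZD : P.-integrable D (EFin \o Z) by exact: integrableS iZ.
  have iYD : P.-integrable D (EFin \o Y) by exact: integrableS iY.
  have := ZE D KD.
  under [in X in _ -> X]eq_integral do rewrite EFinN.
  under [in X in _ -> _ = X]eq_integral do rewrite EFinN.
  by rewrite integralN ?integrable_add_def// integralN ?integrable_add_def// => ->.
Qed.

Lemma pastableN (I : Type) (A : set I) (Y : I -> W -> R) :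
  pastable A Y -> pastable A (fun i w => (- Y i w)%R).
Proof.
move=> pY D i1 i2 KD Ai1 Ai2; have [i Ai [h1 h2]] := pY D i1 i2 KD Ai1 Ai2.
by exists i => //; split; [apply: filterS h1|apply: filterS h2] => w h /h ->.
Qed.

Lemma esssup_cond_exp (I : Type) (A : set I) (p Z : I -> W -> R) (M : R) :
  A !=set0 -> (forall a, A a -> P.-integrable setT (EFin \o p a)) ->
  (forall a, A a -> {ae P, forall w, (`|p a w| <= M)%R}) ->
  (forall a, A a -> is_cond_exp P K (p a) (Z a)) ->
  pastable A p ->
  exists eta : W -> \bar R, is_esssup P A (fun a => EFin \o Z a) eta.
Proof.
move=> A0 ip pM pZ pasteA.
have [a Aa|a Aa|a Aa|eta [_ inf_eta _ _]] :=
  @essinf_cond_exp I A (fun a w => - p a w)%R (fun a w => - Z a w)%R M A0 _ _ _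
    (pastableN pasteA).
- exact: integrableN (ip _ Aa).
- by apply: filterS (pM _ Aa) => w; rewrite normrN.
- exact: is_cond_expN (ip _ Aa) (pZ _ Aa).
exists (fun w => - eta w); have := is_essinfN inf_eta; congr is_esssup.
by apply/funext => a; apply/funext => w; rewrite /= opprK.
Qed.

(** The previous lemma for the opposite payoffs, with the players exchanged. *)
Lemma essinf_esssup_cond_exp (I J : Type) (A : set I) (B : set J)
    (p Z : I -> J -> W -> R) (V : J -> W -> \bar R) (M : R) :
  A !=set0 -> B !=set0 ->
  (forall a b, A a -> B b -> P.-integrable setT (EFin \o p a b)) ->
  (forall a b, A a -> B b -> {ae P, forall w, (`|p a b w| <= M)%R}) ->
  (forall a b, A a -> B b -> is_cond_exp P K (p a b) (Z a b)) ->
  (forall b, B b -> pastable A (p ^~ b)) ->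
  (forall D b1 b2, K D -> B b1 -> B b2 -> exists2 b3, B b3 & forall a, A a ->
    {ae P, forall w, D w -> p a b3 w = p a b1 w} /\
    {ae P, forall w, ~ D w -> p a b3 w = p a b2 w}) ->
  (forall b, B b -> is_esssup P A (fun a => EFin \o Z a b) (V b)) ->
  exists eta : W -> \bar R, [/\ is_essinf P B V eta,
    P.-integrable setT eta &
    \int[P]_w eta w = ereal_inf [set ereal_sup [set \int[P]_w (p a b w)%:E
                                               | a in A] | b in B]].
Proof.
move=> A0 B0 ip pM pZ pasteA pasteB Vsup.
pose p' b a w := (- p a b w)%R; pose Z' b a w := (- Z a b w)%R.
pose V' b w := - V b w.
have ip' b a : B b -> A a -> P.-integrable setT (EFin \o p' b a).
  by move=> Bb Aa; apply: integrableN (ip _ _ Aa Bb).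
have [|b a Bb Aa|b Bb|D b1 b2 KD Bb1 Bb2|b Bb|eta [eta_sup ieta etaE]] :=
  @esssup_essinf_cond_exp J I B A p' Z' V' M B0 A0 ip'.
- by move=> b a Bb Aa; apply: filterS (pM _ _ Aa Bb) => w; rewrite normrN.
- exact: is_cond_expN (ip _ _ Aa Bb) (pZ _ _ Aa Bb).
- exact: pastableN (pasteA b Bb).
- have [b3 Bb3 h3] := pasteB D b1 b2 KD Bb1 Bb2; exists b3 => // a /h3[h1 h2].
  by split; [apply: filterS h1|apply: filterS h2] => w h /h; rewrite /p' => ->.
- exact: is_esssupN (Vsup _ Bb).
exists (fun w => - eta w); split.
- have := is_esssupN eta_sup; congr is_essinf.
  by apply/funext => b; apply/funext => w; rewrite /V' oppeK.
- exact: integrableN ieta.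
- rewrite integralN ?integrable_add_def// etaE -ereal_infN image_comp.
  congr ereal_inf; apply: eq_imagel => b Bb /=.
  rewrite -ereal_supN image_comp; congr ereal_sup; apply: eq_imagel => a Aa /=.
  rewrite /p'; under eq_integral do rewrite EFinN.
  by rewrite integralN ?oppeK// integrable_add_def//; exact: ip.
Qed.

End cond_exp.

(** * Measurability of the vector field *)

Section simple_limit.
Context {dsp : measure_display} {Z : measurableType dsp} {R : realType}.
Variable D : set Z.
Hypothesis mD : measurable D.

(** Pointwise limits of countably valued measurable maps: [c n] is the
    measurable index of the value and [e n] lists the values. Unlike
    Borel measurability, this notion passes to products and to continuous images
    for arbitrary topological spaces. *)
Definition simple_limit (M : topologicalType) (h : Z -> M) :=
  exists (C : countType) (c : nat -> Z -> C) (e : nat -> C -> M),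
    (forall n k, measurable (D `&` c n @^-1` [set k])) /\
    forall z, D z -> (fun n => e n (c n z)) @ \oo --> h z.

Lemma simple_limit_pair (M1 M2 : topologicalType) (h1 : Z -> M1) (h2 : Z -> M2) :
  simple_limit h1 -> simple_limit h2 ->
  simple_limit (fun z => (h1 z, h2 z) : M1 * M2).
Proof.
move=> [C1 [c1 [e1 [mc1 cv1]]]] [C2 [c2 [e2 [mc2 cv2]]]].
exists (C1 * C2)%type, (fun n z => (c1 n z, c2 n z)),
  (fun n k => (e1 n k.1, e2 n k.2)); split.
  move=> n [k1 k2]; have := measurableI _ _ (mc1 n k1) (mc2 n k2).
  rewrite setIACA setIid; congr (measurable (_ `&` _)).
  by apply/seteqP; split=> z /= [-> ->].
by move=> z Dz; apply: cvg_pair; [exact: cv1|exact: cv2].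
Qed.

Lemma simple_limit_comp (M M' : topologicalType) (F : M -> M') (h : Z -> M) :
  continuous F -> simple_limit h -> simple_limit (F \o h).
Proof.
move=> cF [C [c [e [mc cv]]]]; exists C, c, (fun n k => F (e n k)); split => //.
by move=> z Dz; apply: (cvg_comp _ _ (cv z Dz)); exact: cF.
Qed.

Lemma simple_limit_measurable (h : Z -> R) :
  simple_limit h -> measurable_fun D h.
Proof.
move=> [C [c [e [mc cv]]]].
apply: (@measurable_fun_cvg _ _ _ D (fun n z => e n (c n z))) => // n _ B mB.
rewrite (_ : _ `&` _ =
    \bigcup_k if `[< B (e n k) >] then D `&` c n @^-1` [set k] else set0).
  apply: countable_bigcupT_measurable => [|k]; last by case: ifP.
  exact: countableP.
apply/seteqP; split=> [z [Dz Bz]|z [k _]].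
  by exists (c n z) => //; case: asboolP.
by case: asboolP => // Bk [Dz /= zk]; split => //=; rewrite zk.
Qed.

Lemma near_harmonic_lt (e : R) : 0 < e ->
  \forall n \near \oo, n.+1%:R^-1 < e.
Proof. by move=> e0; exact: (near_infty_natSinv_lt (PosNum e0)). Qed.

Lemma floor_approx (y : R) (n : nat) :
  `|y - (Num.floor (y * n.+1%:R))%:~R / n.+1%:R| <= n.+1%:R^-1.
Proof.
have n0 : 0 < n.+1%:R :> R by [].
have /andP[h1 h2] := floor_itv (y * n.+1%:R).
set k := Num.floor _ in h1 h2 *.
have -> : y - k%:~R / n.+1%:R = (y * n.+1%:R - k%:~R) / n.+1%:R.
  by rewrite mulrBl mulfK// gt_eqF.
rewrite normrM [X in _ * X]ger0_norm ?invr_ge0// ger0_norm ?subr_ge0//.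
by rewrite ler_piMl ?invr_ge0 ?(ltW n0)// lerBlDl ltW// -intrD1.
Qed.

Lemma measurable_floor_preimage (h : Z -> R) (n : nat) (k : int) :
  measurable_fun D h ->
  measurable (D `&` (fun z => Num.floor (h z * n.+1%:R)) @^-1` [set k]).
Proof.
move=> mh; have mhn : measurable_fun D (fun z => h z * n.+1%:R).
  exact: measurable_funM.
have := mhn mD `[k%:~R, (k + 1)%:~R[%classic (measurable_itv _).
congr (measurable (_ `&` _)); apply/seteqP; split=> z /=.
  by rewrite in_itv/= => h'; apply: floor_def.
by move=> <-; rewrite in_itv/= floor_itv.
Qed.

Lemma simple_limit_real (h : Z -> R) : measurable_fun D h -> simple_limit h.
Proof.
move=> mh; exists int, (fun n z => Num.floor (h z * n.+1%:R)),
  (fun n k => k%:~R / n.+1%:R); split.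
  by move=> n k; exact: measurable_floor_preimage.
move=> z Dz; apply/cvgrPdist_lt => e /near_harmonic_lt.
by apply: filterS => n; apply: le_lt_trans; exact: floor_approx.
Qed.

Lemma simple_limit_row (d : nat) (X : Z -> 'rV[R]_d) :
  (forall i, measurable_fun D (fun z => X z 0 i)) -> simple_limit X.
Proof.
move=> mX; exists {ffun 'I_d -> int},
  (fun n z => [ffun i => Num.floor (X z 0 i * n.+1%:R)]),
  (fun n (k : {ffun 'I_d -> int}) => \row_i ((k i)%:~R / n.+1%:R)); split.
  move=> n k; rewrite (_ : _ `&` _ = D `&` \bigcap_(i in [set: 'I_d])
     (D `&` (fun z => Num.floor (X z 0 i * n.+1%:R)) @^-1` [set k i])).
    apply: measurableI => //; apply: fin_bigcap_measurable.
      exact: finite_finset.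
    by move=> i _; apply: measurable_floor_preimage.
  apply/seteqP; split=> [z [Dz /= <-]|z [Dz h]].
    by split => // i _; split => //=; rewrite ffunE.
  by split => //=; apply/ffunP => i; rewrite ffunE; have [] := h i I.
move=> z Dz; apply/cvg_ballP => e e0; have := near_harmonic_lt e0.
apply: filterS => n ne; split => // i j; rewrite !mxE ffunE (ord1 i).
by apply: le_lt_trans ne; exact: floor_approx.
Qed.

(** For each [n] a finite set of centres [s n] has balls of radius 1 / (n + 1)
    covering the space. The index of a point is the list of balls that contain
    it, and the value is the centre of the first of them. *)
Lemma simple_limit_compact (E : pmetricType R) (u : Z -> E) :
  compact [set: E] -> measurable_fun D (u : Z -> borel E) -> simple_limit u.
Proof.
move=> cE mu.
have /choice[s sP] (n : nat) : exists s : seq E,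
    forall x : E, exists2 y, y \in s & (ball y (n.+1%:R^-1 : R))° x.
  have n0 : 0 < n.+1%:R^-1 :> R by rewrite invr_gt0.
  move: cE; rewrite compact_cover => /(_ E setT
    (fun y => (ball y (n.+1%:R^-1 : R))°)).
  case=> [y _|y _|D' _ cov].
  - exact: open_interior.
  - exists y => //; exact: nbhsx_ballx.
  - exists (finmap.enum_fset D') => x; have [y /= yD yx] := cov x I.
    by exists y.
pose p n (x y : E) : bool := `[< (ball y (n.+1%:R^-1 : R))° x >].
exists (seq bool), (fun n z => map (p n (u z)) (s n)),
  (fun n bs => nth point (s n) (index true bs)); split.
  move=> n; elim: (s n) => [|y t IH] [|b bs].
  - by rewrite (_ : _ @^-1` _ = setT) ?setIT//; apply/seteqP; split=> z /=.
  - by rewrite (_ : _ @^-1` _ = set0) ?setI0//; apply/seteqP; split=> z /=.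
  - by rewrite (_ : _ @^-1` _ = set0) ?setI0//; apply/seteqP; split=> z /=.
  rewrite (_ : _ `&` _ = (D `&` (fun z => p n (u z) y) @^-1` [set b]) `&`
      (D `&` (fun z => map (p n (u z)) t) @^-1` [set bs])); last first.
    rewrite setIACA setIid; congr (_ `&` _).
    by apply/seteqP; split=> z /= [-> ->].
  apply: measurableI => //.
  have mo : measurable (D `&` u @^-1` (ball y (n.+1%:R^-1 : R))°).
    by apply: mu => //; apply: sub_sigma_algebra; exact: open_interior.
  case: b.
    move: mo; congr (measurable (_ `&` _)).
    by apply/seteqP; split=> z /= /asboolP.
  have := measurableD mD mo; congr measurable.
  apply/seteqP; split=> z /=.
    move=> [Dz h]; split => //.
    by apply/asboolPn => h'; apply: h; split.
  by move=> [Dz /asboolPn h]; split => // -[_].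
move=> z Dz; apply/cvg_ballP => e /near_harmonic_lt.
apply: filterS => n ne; set y := nth _ _ _.
suff : p n (u z) y.
  move=> /asboolP /interior_subset yz; apply: ball_sym.
  exact: (le_ball (ltW ne)).
have := sP n (u z); rewrite /y.
elim: (s n) => [[//]|a t IH [b]] /=.
have [pa _ _ //|pa] := boolP (p n (u z) a).
rewrite inE => /predU1P[-> h|bt h].
  by move/asboolP: pa.
by apply: IH; exists b.
Qed.

End simple_limit.

Lemma within_continuous_comp (X Y Y' : topologicalType) (A : set Y)
    (F : Y -> Y') (G : X -> Y) :
  {within A, continuous F} -> continuous G -> (forall x, A (G x)) ->
  continuous (F \o G).
Proof.
move=> cF cG AG x B nB.
have h : within A (nbhs (G x)) (F @^-1` B).
  by rewrite nbhs_subspace_in//; exact: (cF (G x) B nB).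
have hG : nbhs x (G @^-1` [set y | A y -> B (F y)]) by exact: (cG x _ h).
by apply: (filterS _ hG) => y h'; exact: (h' (AG y)).
Qed.

Lemma continuous_pair (X Y Y' : topologicalType) (f : X -> Y) (g : X -> Y') :
  continuous f -> continuous g -> continuous (fun x => (f x, g x)).
Proof. by move=> cf cg x; apply: cvg_pair; [exact: cf|exact: cg]. Qed.

Section measurable_field.
Context {dsp : measure_display} {Z : measurableType dsp} {R : realType}.
Variables (D : set Z) (d : nat) (U V : pmetricType R) (T : R).
Variable f : R -> 'rV[R]_d -> U -> V -> 'rV[R]_d.
Hypotheses (mD : measurable D) (T0 : 0 <= T).
Hypotheses (cU : compact [set: U]) (cV : compact [set: V]).
Hypothesis cf : {within [set z : R * 'rV[R]_d * U * V | 0 <= z.1.1.1 <= T],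
  continuous (fun z => f z.1.1.1 z.1.1.2 z.1.2 z.2)}.

(** Time is clamped to the interval from 0 to [T] so as to replace [f] by a
    function that is continuous everywhere. *)
Lemma measurable_field (q : Z -> R) (X : Z -> 'rV[R]_d) (u : Z -> U) (v : Z -> V) i :
  measurable_fun D q -> (forall j, measurable_fun D (fun z => X z 0 j)) ->
  measurable_fun D (u : Z -> borel U) -> measurable_fun D (v : Z -> borel V) ->
  (forall z, D z -> 0 <= q z <= T) ->
  measurable_fun D (fun z => f (q z) (X z) (u z) (v z) 0 i).
Proof.
move=> mq mX mu mv q0T.
pose clamp (z : R * 'rV[R]_d * U * V) : R * 'rV[R]_d * U * V :=
  (Num.max 0 (Num.min z.1.1.1 T), z.1.1.2, z.1.2, z.2).
have c_clamp : continuous clamp.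
  have c1 : continuous (fun z : R * 'rV[R]_d * U * V => z.1).
    by move=> z; exact: cvg_fst.
  have c11 : continuous (fun z : R * 'rV[R]_d * U * V => z.1.1).
    by move=> z; apply: (cvg_comp _ _ (c1 z)); exact: cvg_fst.
  have c111 : continuous (fun z : R * 'rV[R]_d * U * V => z.1.1.1).
    by move=> z; apply: (cvg_comp _ _ (c11 z)); exact: cvg_fst.
  apply: continuous_pair; last by move=> z; exact: cvg_snd.
  apply: continuous_pair; last by move=> z; apply: (cvg_comp _ _ (c1 z)); exact: cvg_snd.
  apply: continuous_pair; last by move=> z; apply: (cvg_comp _ _ (c11 z)); exact: cvg_snd.
  move=> z; apply: (@continuous_max _ _ (cst 0) (fun z' : R * 'rV[R]_d * U * V =>
    Num.min z'.1.1.1 T)); first exact: cvg_cst.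
  apply: (@continuous_min _ _ (fun z' : R * 'rV[R]_d * U * V => z'.1.1.1) (cst T)).
    exact: c111.
  exact: cvg_cst.
pose F z := (f z.1.1.1 z.1.1.2 z.1.2 z.2 : 'rV[R]_d) 0 i.
have cF : continuous (F \o clamp).
  have cfc : continuous ((fun z => f z.1.1.1 z.1.1.2 z.1.2 z.2) \o clamp).
    apply: (within_continuous_comp cf c_clamp) => z /=.
    by rewrite le_max lexx/= ge_max T0 ge_min lexx orbT.
  have cc : continuous (fun M : 'rV[R]_d => M 0 i) by exact: coord_continuous.
  by move=> z; exact: (continuous_comp (cfc z) (cc _)).
have sl : simple_limit D (fun z => (q z, X z, u z, v z) : R * 'rV[R]_d * U * V).
  have qX := simple_limit_pair (simple_limit_real mD mq) (simple_limit_row mD mX).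
  have qXu := simple_limit_pair qX (simple_limit_compact mD cU mu).
  exact: (simple_limit_pair qXu (simple_limit_compact mD cV mv)).
have := simple_limit_measurable (simple_limit_comp cF sl).
apply: eq_measurable_fun => z /set_mem Dz.
have /andP[q0 qT] := q0T z Dz.
by rewrite /F /clamp/= (min_idPl qT) (max_idPr q0).
Qed.
End measurable_field.

Lemma measurable_continuous_row {dsp} {Z : measurableType dsp} {R : realType}
    (D : set Z) (d : nat) (g : 'rV[R]_d -> R) (X : Z -> 'rV[R]_d) :
  measurable D -> continuous g ->
  (forall j, measurable_fun D (fun z => X z 0 j)) ->
  measurable_fun D (fun z => g (X z)).
Proof.
move=> mD cg mX; apply: simple_limit_measurable.
exact: (simple_limit_comp cg (simple_limit_row mD mX)).
Qed.

(** * Differential equations with a parameter *)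

(** a_n - 2c/2^n increases and a_n + 2c/2^n decreases, so that any number
    between the two sequences is a limit with an explicit rate. *)
Lemma geometric_limit (R : realType) (a : nat -> R) (c : R) :
  (forall n, `|a n.+1 - a n| <= c / 2 ^+ n) ->
  exists L, forall n, `|a n - L| <= c *+ 2 / 2 ^+ n.
Proof.
move=> ac; pose lo n := a n - c *+ 2 / 2 ^+ n; pose up n := a n + c *+ 2 / 2 ^+ n.
have half n : c *+ 2 / 2 ^+ n.+1 = c / 2 ^+ n.
  by rewrite exprS; field; rewrite expf_neq0.
have step n : lo n <= lo n.+1 /\ up n.+1 <= up n.
  have := ac n; rewrite ler_norml /lo /up half mulr2n mulrDl => /andP[h1 h2].
  by split; lra.
have lo_nd m n : (m <= n)%N -> lo m <= lo n.
  by apply: (@homo_leq _ lo <=%R) => // [? ? ?|k]; [exact: le_trans|case: (step k)].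
have up_ni m n : (m <= n)%N -> up n <= up m.
  have h := @homo_leq _ (fun n => - up n) <=%R.
  move=> mn; rewrite -lerN2; apply: h mn => // [? ? ?|k]; first exact: le_trans.
  by rewrite lerN2; case: (step k).
have lo_up n : lo n <= up n.
  have c0 : 0 <= c by have := ac 0%N; rewrite expr0 divr1; apply: le_trans.
  have : 0 <= c *+ 2 / 2 ^+ n by rewrite divr_ge0 ?mulrn_wge0 ?exprn_ge0.
  by rewrite /lo /up => h; lra.
have lo_le_up m n : lo m <= up n.
  apply: (le_trans (lo_nd _ _ (leq_maxl m n))).
  by apply: (le_trans (lo_up _)); apply: up_ni; rewrite leq_maxr.
exists (sup (range lo)) => n; rewrite ler_norml.
have hs : has_sup (range lo).
  split; first by exists (lo 0%N), 0%N.
  by exists (up 0%N) => _ [m _ <-].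
have h1 : lo n <= sup (range lo).
  by apply: ub_le_sup; [case: hs|exists n].
have h2 : sup (range lo) <= up n.
  by apply: ge_sup; [exists (lo 0%N), 0%N|move=> _ [m _ <-]].
by rewrite /lo /up in h1 h2; apply/andP; split; lra.
Qed.

Lemma cvg_geometric_bound (R : realType) (a : nat -> R) (c L : R) :
  (forall n, `|a n - L| <= c / 2 ^+ n) -> a @ \oo --> L.
Proof.
move=> h.
have h0 : geometric c (2^-1) @ \oo --> (0 : R).
  by apply: cvg_geometric; rewrite ger0_norm// invf_lt1// ltr1n.
apply/cvgrPdist_le => e e0.
near=> n.
have : `|0 - geometric c (2^-1) n| <= e by near: n; exact: cvgr_dist_le.
apply: le_trans; rewrite distrC sub0r normrN /geometric/= (le_trans (h n))// exprVn.
exact: ler_norm.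
Unshelve. all: by end_near. Qed.

Lemma geometric_eq0 (R : realType) (a c : R) :
  (forall n, `|a| <= c / 2 ^+ n) -> a = 0.
Proof.
move=> h.
have h1 : (fun _ : nat => a) @ \oo --> (0 : R).
  by apply: (@cvg_geometric_bound _ _ c) => n; rewrite subr0.
have h2 : (fun _ : nat => a) @ \oo --> a by exact: cvg_cst.
exact: (cvg_unique _ h2 h1).
Qed.

Lemma row_norm_le (R : realType) (d : nat) (A : 'rV[R]_d) (c : R) :
  0 <= c -> (forall i, `|A 0 i| <= c) -> `|A| <= c.
Proof.
move=> c0 Ac; rewrite /Num.norm/= mx_normrE; apply: bigmax_le => // -[i j] _ /=.
by rewrite (ord1 i).
Qed.

Lemma row_coord_le (R : realType) (d : nat) (A : 'rV[R]_d) i : `|A 0 i| <= `|A|.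
Proof.
rewrite [leRHS]/Num.norm/= mx_normrE.
exact: (@le_bigmax _ _ _ 0 (fun ij : 'I_1 * 'I_d => `|A ij.1 ij.2|) (0, i)).
Qed.

Section parametric_integral.
Context {dsp : measure_display} {W : measurableType dsp} {R : realType}.
Local Notation mu := (@lebesgue_measure R).
Implicit Types (t r : R) (M : R).

Lemma bounded_integrable_itv (h : R -> R) M t r :
  measurable_fun setT h -> (forall q, `|h q| <= M) ->
  mu.-integrable `[t, r] (EFin \o h).
Proof.
move=> mh hM; apply: measurable_bounded_integrable => //.
- by rewrite /= lebesgue_measure_itv/=; case: ifP => _; rewrite ?ltry// -EFinB ltry.
- exact: measurable_funTS.
- exists M; split; first exact: num_real.
  by move=> m Mm q _ /=; apply: (le_trans (hM q)); exact: ltW.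
Qed.

Lemma normr_int_le (h : R -> R) M t r : measurable_fun setT h ->
  (forall q, `|h q| <= M) -> `|\int[mu]_(q in `[t, r]) h q| <= M * Num.max 0 (r - t).
Proof.
move=> mh hM.
apply: (le_trans (le_normr_Rintegral _ (bounded_integrable_itv _ _ mh hM))) => //.
have mnh : measurable_fun setT (fun q => `|h q|) by exact: measurableT_comp.
apply: (@le_trans _ _ (\int[mu]_(q in `[t, r]) M)).
  apply: le_Rintegral => //.
  - by apply: (bounded_integrable_itv (M := M)) => // q; rewrite normr_id.
  - by apply: (bounded_integrable_itv (M := `|M|)).
have M0 : 0 <= M by apply: le_trans (hM 0).
rewrite Rintegral_cst// ler_wpM2l//= lebesgue_measure_itv/= lte_fin.
by case: ltP => tr /=; rewrite le_max lexx ?orbT.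
Qed.

(** Tonelli's theorem for the indicator of {t <= q <= r} times H, after adding
    a constant that makes H nonnegative. *)
Lemma measurable_parametric_integral (H : measurableTypeR R * W -> R) M t :
  measurable_fun setT H -> (forall z, `|H z| <= M) ->
  measurable_fun setT (fun z : measurableTypeR R * W =>
    \int[mu]_(q in `[t, z.1]) H (q, z.2)).
Proof.
move=> mH HM.
have M0 : 0 <= M by apply: le_trans (HM point).
have ge0_case (G : measurableTypeR R * W -> R) : measurable_fun setT G ->
    (forall z, 0 <= G z) ->
    measurable_fun setT (fun z : measurableTypeR R * W =>
      \int[mu]_(q in `[t, z.1]) G (q, z.2)).
  move=> mG G0.
  pose F (y : (measurableTypeR R * W) * measurableTypeR R) : \bar R :=
    (if (t <= y.2) && (y.2 <= y.1.1) then G (y.2, y.1.2) else 0)%:E.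
  have mF : measurable_fun setT F.
    apply/measurable_EFinP; apply: measurable_fun_ifT => //=.
      apply: measurable_and; apply: measurable_fun_ler => //.
      exact: measurableT_comp.
    apply: measurableT_comp mG _; apply: measurable_fun_pair => //.
    exact: measurableT_comp.
  have F0 y : (0 <= F y)%E by rewrite lee_fin; case: ifP.
  have := measurable_fun_fubini_tonelli_F (m2 := mu) F mF F0.
  move=> mFF; apply: (@eq_measurable_fun _ _ _ _ _
      (fun z => fine (\int[mu]_q F (z, q))%E)); last first.
    by apply: measurableT_comp mFF; exact: fine_measurable.
  move=> z _; rewrite /Rintegral; congr fine; rewrite [RHS]integral_mkcond.
  apply: eq_integral => q _; rewrite /F patchE.
  by rewrite mem_setE in_itv/=; case: ifP.
have -> : (fun z : measurableTypeR R * W => \int[mu]_(q in `[t, z.1]) H (q, z.2)) =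
  (fun z => \int[mu]_(q in `[t, z.1]) (H (q, z.2) + M) - \int[mu]_(q in `[t, z.1]) M).
  apply/funext => z; rewrite RintegralD//= ?addrK//.
  - apply: (bounded_integrable_itv (h := fun q => H (q, z.2)) (M := M)) => //.
    exact: measurable_fun_pair1.
  - by apply: (bounded_integrable_itv (h := fun q => M) (M := M)) => // q; rewrite ger0_norm.
apply: measurable_funB.
  apply: (ge0_case (fun z => H z + M)); first exact: measurable_funD.
  by move=> z; have := HM z; rewrite ler_norml => /andP[? _]; lra.
exact: (ge0_case (fun=> M)).
Qed.

End parametric_integral.

Section exponential_weight.
Variables (R : realType) (k t : R).
Hypothesis k0 : 0 < k.
Local Notation mu := (@lebesgue_measure R).

(** Dividing by this weight makes the Picard map a contraction of ratio 1/2 on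
    the whole half-line, as 2 k times the integral of the weight from [t] to
    [r] is at most its value at [r]. *)
Definition weight (q : R) := expR (2 * k * (q - t)).

Lemma weight_gt0 q : 0 < weight q. Proof. exact: expR_gt0. Qed.

Lemma le_weight q : 2 * k * (q - t) <= weight q.
Proof. by have := expR_ge1Dx (2 * k * (q - t)); rewrite /weight => h; lra. Qed.

Lemma weight_derive (q : R) : is_derive q 1 weight (2 * k * weight q).
Proof.
by rewrite /weight; apply: is_derive_eq; rewrite /GRing.scale/=; ring.
Qed.

Lemma continuous_weight : continuous weight.
Proof.
move=> q; apply: differentiable_continuous; apply/derivable1_diffP.
by case: (weight_derive q).
Qed.

Lemma int_weight_le (r : R) : t <= r ->
  \int[mu]_(q in `[t, r]) (2 * k * weight q) <= weight r.
Proof.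
rewrite le_eqVlt => /predU1P[<-|tr].
  by rewrite set_itv1 Rintegral_set1 ltW// weight_gt0.
rewrite /Rintegral (@continuous_FTC2 _ _ weight)//.
- by rewrite /= gerBl ltW// weight_gt0.
- apply: continuous_subspaceT => q; apply: cvgM; first exact: cvg_cst.
  exact: continuous_weight.
- split.
  + by move=> q _; case: (weight_derive q).
  + by apply/cvg_at_right_filter; exact: continuous_weight.
  + by apply/cvg_at_left_filter; exact: continuous_weight.
- move=> q _; rewrite derive1E.
  by case: (weight_derive q).
Qed.

End exponential_weight.

Lemma div_exprS (R : realType) (c : R) n : c / 2 ^+ n.+1 = c / 2 ^+ n / 2.
Proof. by rewrite exprSr invfM mulrA. Qed.

Section caratheodory.
Context {dsp : measure_display} {W : measurableType dsp} {R : realType}.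
Variables (d : nat) (F : R -> 'rV[R]_d -> W -> 'rV[R]_d).
Variables (M k t : R) (x : 'rV[R]_d).
Local Notation mu := (@lebesgue_measure R).

Definition jointly_measurable (X : R -> W -> 'rV[R]_d) := forall i,
  measurable_fun setT (fun z : measurableTypeR R * W => X z.1 z.2 0 i).

Hypothesis mF : forall X, jointly_measurable X ->
  jointly_measurable (fun q w => F q (X q w) w).
Hypothesis bF : forall q y w, `|F q y w| <= M.
Hypothesis lF : forall q y y' w, `|F q y w - F q y' w| <= k * `|y - y'|.
Hypothesis k0 : 0 < k.

Local Notation weight := (weight k t).

Definition picard (X : R -> W -> 'rV[R]_d) (r : R) (w : W) : 'rV[R]_d :=
  \row_i (x 0 i + \int[mu]_(q in `[t, r]) F q (X q w) w 0 i).

Let bFi q y w i : `|F q y w 0 i| <= M.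
Proof. exact: le_trans (row_coord_le _ i) (bF q y w). Qed.

Lemma measurable_section (X : R -> W -> 'rV[R]_d) w i : jointly_measurable X ->
  measurable_fun setT (fun q : R => X q w 0 i).
Proof.
move=> mX; exact: (@measurable_fun_pair1 _ _ _ _ _ _
  (fun z : measurableTypeR R * W => X z.1 z.2 0 i) w (mX i)).
Qed.

Lemma picard_measurable X : jointly_measurable X -> jointly_measurable (picard X).
Proof.
move=> mX i.
rewrite (_ : (fun z => _) = (fun z : measurableTypeR R * W =>
  x 0 i + \int[mu]_(q in `[t, z.1]) F q (X q z.2) z.2 0 i)); last first.
  by apply/funext => z; rewrite mxE.
apply: measurable_funD => //.
apply: (@measurable_parametric_integral _ _ _
  (fun z => F z.1 (X z.1 z.2) z.2 0 i) M) => [|z]; last exact: bFi.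
exact: mF.
Qed.

(** At time [q] the integrands differ by at most k C weight(q), and the factor
    1/2 comes from [int_weight_le]. *)
Lemma picard_contraction X Y w r C : 0 <= C ->
  jointly_measurable X -> jointly_measurable Y ->
  (forall q, t <= q <= r -> `|X q w - Y q w| <= C * weight q) ->
  `|picard X r w - picard Y r w| <= C / 2 * weight r.
Proof.
move=> C0 mX mY XY.
have wr0 : 0 <= C / 2 * weight r by rewrite mulr_ge0 ?divr_ge0// ltW// weight_gt0.
apply: row_norm_le => // i; rewrite !mxE opprD addrACA subrr add0r.
have [rt|tr] := ltP r t.
  by rewrite set_itv_ge ?bnd_simp -?ltNge// !Rintegral_set0 subrr normr0.
have mG Z : jointly_measurable Z ->
    measurable_fun setT (fun q : R => F q (Z q w) w 0 i).
  by move=> mZ; apply: (measurable_section w i (mF mZ)).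
have iG Z : jointly_measurable Z ->
    mu.-integrable `[t, r] (EFin \o (fun q => F q (Z q w) w 0 i)).
  by move=> mZ; apply: (bounded_integrable_itv (M := M)); [exact: mG|].
rewrite -RintegralB//; [|exact: iG|exact: iG].
have mD : measurable_fun setT (fun q : R => F q (X q w) w 0 i - F q (Y q w) w 0 i).
  by apply: measurable_funB; exact: mG.
have bD q : `|F q (X q w) w 0 i - F q (Y q w) w 0 i| <= M + M.
  by rewrite (le_trans (ler_normB _ _))// lerD.
apply: (le_trans (le_normr_Rintegral _ (bounded_integrable_itv _ _ mD bD))) => //.
apply: (@le_trans _ _ (\int[mu]_(q in `[t, r]) (C / 2 * (2 * k * weight q)))).
  apply: le_Rintegral => //.
  - exact: (integrable_norm (bounded_integrable_itv _ _ mD bD)).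
  - apply: continuous_compact_integrable; first exact: segment_compact.
    apply: continuous_subspaceT => q.
    apply: cvgM; first exact: cvg_cst.
    by apply: cvgM; [exact: cvg_cst|exact: continuous_weight].
  - move=> q; rewrite /= in_itv/= => /XY h.
    have -> : C / 2 * (2 * k * weight q) = k * (C * weight q) by field.
    have := row_coord_le (F q (X q w) w - F q (Y q w) w) i; rewrite !mxE.
    move=> /le_trans; apply; apply: (le_trans (lF _ _ _ _)).
    by rewrite ler_pM2l.
rewrite RintegralZl//; last first.
  apply: continuous_compact_integrable; first exact: segment_compact.
  apply: continuous_subspaceT => q.
  by apply: cvgM; [exact: cvg_cst|exact: continuous_weight].
rewrite ler_wpM2l ?divr_ge0//; exact: int_weight_le.
Qed.

(** A bound that starts the contraction: the displacement M (r - t) is at most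
    M / (2 k) times the weight. *)
Lemma picard_diff_le X w r i : jointly_measurable X ->
  `|picard X r w 0 i - x 0 i| <= M / (2 * k) * weight r.
Proof.
move=> mX; rewrite mxE addrC addKr.
have mG : measurable_fun setT (fun q : R => F q (X q w) w 0 i).
  exact: (measurable_section w i (mF mX)).
apply: (le_trans (normr_int_le t r mG (fun q => bFi q _ w i))).
have M0 : 0 <= M by apply: le_trans (bF 0 x w).
rewrite -mulrA ler_wpM2l// ler_pdivlMl ?mulr_gt0//.
case: (leP 0 (r - t)) => _; first exact: le_weight.
by rewrite mulr0 ltW// weight_gt0.
Qed.

Definition picard_iter (n : nat) : R -> W -> 'rV[R]_d :=
  iter n picard (fun _ _ => x).

Lemma picard_iter_measurable n : jointly_measurable (picard_iter n).
Proof.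
by elim: n => [i|n IH]; [exact: measurable_cst|exact: picard_measurable].
Qed.

Lemma picard_iter_step n r w :
  `|picard_iter n.+1 r w - picard_iter n r w| <= M / (2 * k) / 2 ^+ n * weight r.
Proof.
have M0 : 0 <= M by apply: le_trans (bF 0 x w).
have C0 : 0 <= M / (2 * k) by rewrite divr_ge0 ?mulr_ge0// ltW.
elim: n r => [|n IH] r.
  rewrite expr0 divr1; apply: row_norm_le => [|i].
    by rewrite mulr_ge0// ltW// weight_gt0.
  have := @picard_diff_le (picard_iter 0) w r i (@picard_iter_measurable 0).
  by rewrite !mxE.
have Cn0 : 0 <= M / (2 * k) / 2 ^+ n by rewrite divr_ge0// exprn_ge0.
rewrite div_exprS.
exact: (picard_contraction Cn0 (@picard_iter_measurable n.+1)
  (@picard_iter_measurable n) (fun q (_ : t <= q <= r) => IH q)).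
Qed.

Definition picard_lim (r : R) (w : W) : 'rV[R]_d :=
  \row_i lim (picard_iter n r w 0 i @[n --> \oo]).

Lemma picard_iter_lim n r w :
  `|picard_iter n r w - picard_lim r w| <= M / k / 2 ^+ n * weight r.
Proof.
have M0 : 0 <= M by apply: le_trans (bF 0 x w).
have C0 : 0 <= M / k / 2 ^+ n * weight r.
  by rewrite !mulr_ge0 ?invr_ge0 ?exprn_ge0// ltW// weight_gt0.
apply: row_norm_le => // i; rewrite !mxE.
have [|L aL] := @geometric_limit R (fun n => picard_iter n r w 0 i)
  (M / (2 * k) * weight r).
  move=> m; have := row_coord_le (picard_iter m.+1 r w - picard_iter m r w) i.
  rewrite !mxE => /le_trans; apply; apply: (le_trans (picard_iter_step m r w)).
  by rewrite mulrAC.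
rewrite (cvg_lim _ (cvg_geometric_bound aL))//; apply: (le_trans (aL n)).
rewrite le_eqVlt; apply/orP; left; apply/eqP; field.
by rewrite expf_neq0//= gt_eqF.
Qed.

Lemma picard_lim_measurable : jointly_measurable picard_lim.
Proof.
move=> i; apply: (@measurable_fun_cvg _ _ _ setT
  (fun n (z : measurableTypeR R * W) => picard_iter n z.1 z.2 0 i)) => [n|z _].
  exact: picard_iter_measurable.
apply: (@cvg_geometric_bound _ _ (M / k * weight z.1)) => n.
have := row_coord_le (picard_iter n z.1 z.2 - picard_lim z.1 z.2) i.
rewrite !mxE => /le_trans; apply; apply: (le_trans (picard_iter_lim n z.1 z.2)).
by rewrite mulrAC.
Qed.

(** Both sides are close to the same iterate [picard_iter n.+1]. *)
Lemma picard_limE : picard_lim = picard picard_lim.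
Proof.
apply/funext => r; apply/funext => w; apply/eqP; rewrite -subr_eq0 -normr_eq0.
apply/eqP; apply: (@geometric_eq0 _ _ (M / k * weight r)) => n; rewrite normr_id.
have M0 : 0 <= M by apply: le_trans (bF 0 x w).
have C0 : 0 <= M / k / 2 ^+ n by rewrite !mulr_ge0 ?invr_ge0 ?exprn_ge0// ltW.
have h1 := picard_iter_lim n.+1 r w.
have h2 : `|picard_iter n.+1 r w - picard picard_lim r w| <=
    M / k / 2 ^+ n / 2 * weight r.
  exact: (picard_contraction C0 (@picard_iter_measurable n) picard_lim_measurable
    (fun q _ => picard_iter_lim n q w)).
rewrite (_ : _ - _ = (picard_iter n.+1 r w - picard picard_lim r w) -
  (picard_iter n.+1 r w - picard_lim r w)); last first.
  by rewrite [RHS]addrC opprB addrA subrK.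
apply: (le_trans (ler_normB _ _)); apply: (le_trans (lerD h2 h1)).
rewrite le_eqVlt; apply/orP; left; apply/eqP; rewrite exprS; field.
by rewrite expf_neq0//= gt_eqF.
Qed.

(** Two solutions differ by at most a multiple of the weight, and each use of
    the equation halves that multiple. *)
Lemma picard_unique (T : R) (X Y : R -> W -> 'rV[R]_d) (w : W) :
  jointly_measurable X -> jointly_measurable Y ->
  (forall r, t <= r <= T -> X r w = picard X r w) ->
  (forall r, t <= r <= T -> Y r w = picard Y r w) ->
  forall r, t <= r <= T -> X r w = Y r w.
Proof.
move=> mX mY XE YE.
have M0 : 0 <= M by apply: le_trans (bF 0 x w).
have Mk0 : 0 <= M / k by rewrite divr_ge0// ltW.
have key n r : t <= r <= T -> `|X r w - Y r w| <= M / k / 2 ^+ n * weight r.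
  elim: n r => [|n IH] r trT; rewrite XE// YE//.
    rewrite expr0 divr1; apply: row_norm_le => [|i].
      by rewrite mulr_ge0// ltW// weight_gt0.
    have h1 := picard_diff_le w r i mX; have h2 := picard_diff_le w r i mY.
    rewrite mxE [X in _ + X]mxE.
    rewrite (_ : _ - _ = (picard X r w 0 i - x 0 i) - (picard Y r w 0 i - x 0 i)); last first.
      by ring.
    apply: (le_trans (ler_normB _ _)); apply: (le_trans (lerD h1 h2)).
    rewrite le_eqVlt; apply/orP; left; apply/eqP; field.
    by rewrite gt_eqF.
  have Cn0 : 0 <= M / k / 2 ^+ n by rewrite divr_ge0// exprn_ge0.
  have XYr q : t <= q <= r -> `|X q w - Y q w| <= M / k / 2 ^+ n * weight q.
    move=> /andP[tq qr]; apply: IH; rewrite tq (le_trans qr)//.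
    by case/andP: trT.
  rewrite div_exprS.
  exact: (picard_contraction Cn0 mX mY XYr).
move=> r trT; apply/eqP; rewrite -subr_eq0 -normr_eq0; apply/eqP.
apply: (@geometric_eq0 _ _ (M / k * weight r)) => n.
by rewrite normr_id mulrAC; exact: key.
Qed.

End caratheodory.

(** * Trajectories *)

Lemma row_continuous (X : topologicalType) (R : realType) (d : nat)
    (h : X -> 'rV[R]_d) :
  (forall i, continuous (fun x => h x 0 i)) -> continuous h.
Proof.
move=> ch x; apply/cvg_ballP => e e0.
have : \forall y \near x, forall i, ball (h x 0 i) e (h y 0 i).
  apply: filter_forall => i.
  by have /cvg_ballP := ch i x; apply.
by apply: filterS => y h'; split => // i j; rewrite (ord1 i).
Qed.

Section trajectory.
Context {dsp : measure_display} {W : measurableType dsp} {R : realType}.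
Variables (d : nat) (U V : pmetricType R) (T t : R).
Variable f : R -> 'rV[R]_d -> U -> V -> 'rV[R]_d.
Hypothesis t0T : 0 <= t <= T.
Hypotheses (cU : compact [set: U]) (cV : compact [set: V]).
Hypothesis f_bounded : exists M : R,
  forall (r : R) y u v, 0 <= r <= T -> `|f r y u v| <= M.
Hypothesis f_continuous :
  {within [set z : R * 'rV[R]_d * U * V | 0 <= z.1.1.1 <= T],
    continuous (fun z => f z.1.1.1 z.1.1.2 z.1.2 z.2)}.
Hypothesis f_lipschitz : exists k : R, forall (r : R) u v y y', 0 <= r <= T ->
  `|f r y u v - f r y' u v| <= k * `|y - y'|.
Local Notation mu := (@lebesgue_measure R).

Definition measurable_process (E : pmetricType R) (u : R -> W -> E) :=
  measurable_fun (`[t, T] `*` setT)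
    (fun z : measurableTypeR R * W => u z.1 z.2 : borel E).

(** The right-hand side set to 0 outside [t, T], which makes it bounded,
    Lipschitz and measurable for all times. *)
Definition field (u : R -> W -> U) (v : R -> W -> V) q y w :=
  if t <= q <= T then f q y (u q w) (v q w) else 0.

Let le0T q : t <= q <= T -> 0 <= q <= T.
Proof. by move=> /andP[tq ->]; case/andP: t0T => /le_trans ->. Qed.

Let T0 : 0 <= T.
Proof. by case/andP: t0T; exact: le_trans. Qed.

Let mI : measurable (`[t, T] `*` setT : set (measurableTypeR R * W)).
Proof. by apply: measurableX. Qed.

Lemma field_measurable u v X : measurable_process u -> measurable_process v ->
  jointly_measurable X ->
  jointly_measurable (fun q w => field u v q (X q w) w).
Proof.
move=> mu_ mv mX i.
have mf := @measurable_field _ _ _ _ d U V T f mI T0 cU cV f_continuous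
  fst (fun z => X z.1 z.2) _ _ i
  (measurable_funTS measurable_fst) (fun j => measurable_funTS (mX j)) mu_ mv.
have /(_ _)/(measurable_restrictT _ mI) := mf.
have h z : (`[t, T] `*` setT : set (measurableTypeR R * W)) z -> 0 <= z.1 <= T.
  by case=> /=; rewrite in_itv/= => /le0T.
move=> /(_ h); apply: eq_measurable_fun => z _; rewrite /field patchE.
have -> : (z \in (`[t, T] `*` setT : set (measurableTypeR R * W))) = (t <= z.1 <= T).
  apply/idP/idP => [/set_mem[]|h']; first by rewrite /= in_itv.
  by rewrite inE; split; rewrite //= in_itv.
by case: ifP => //; rewrite mxE.
Qed.

Lemma field_bounded : exists M, forall u v q y w, `|field u v q y w| <= M.
Proof.
have [M fM] := f_bounded; exists M => u v q y w; rewrite /field.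
case: ifP => [/le0T/fM//|_]; rewrite normr0.
by apply: (le_trans _ (fM 0 0 point point _)) => //; rewrite lexx T0.
Qed.

Lemma field_lipschitz : exists2 k, 0 < k &
  forall u v q y y' w, `|field u v q y w - field u v q y' w| <= k * `|y - y'|.
Proof.
have [k fk] := f_lipschitz; exists (`|k| + 1); first by rewrite ltr_wpDl.
move=> u v q y y' w; rewrite /field; case: ifP => [/le0T/fk h|_].
  apply: (le_trans (h _ _ _ _)); rewrite ler_wpM2r// (le_trans (ler_norm _))//.
  by rewrite lerDl.
by rewrite subrr normr0 mulr_ge0// addr_ge0.
Qed.

Lemma int_fieldE u v (X : R -> 'rV[R]_d) w r i : r <= T ->
  \int[mu]_(q in `[t, r]) f q (X q) (u q w) (v q w) 0 i =
  \int[mu]_(q in `[t, r]) field u v q (X q) w 0 i.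
Proof.
move=> rT; apply: eq_Rintegral => q; rewrite inE/= in_itv/= => /andP[tq qr].
by rewrite /field tq (le_trans qr).
Qed.

(** The Picard solution serves all [w] at once, and hence is measurable. A
    given trajectory is only known on [t, T], so it is extended by 0 before
    uniqueness is applied. *)
Lemma trajectory_exists (x : 'rV[R]_d) u v :
  measurable_process u -> measurable_process v ->
  exists X : R -> W -> 'rV[R]_d, [/\ jointly_measurable X,
    forall w, is_trajectory f T t x (u ^~ w) (v ^~ w) (X ^~ w) &
    forall w Y, is_trajectory f T t x (u ^~ w) (v ^~ w) Y -> Y T = X T w].
Proof.
move=> mu_ mv; have [M bM] := field_bounded; have [k k0 lk] := field_lipschitz.
have mF X := @field_measurable u v X mu_ mv.
have mX := picard_lim_measurable t x mF (bM u v) (lk u v) k0.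
have XE := picard_limE t x mF (bM u v) (lk u v) k0.
set X := picard_lim _ _ _ in mX XE.
have XE' r w i : X r w 0 i =
    x 0 i + \int[mu]_(q in `[t, r]) field u v q (X q w) w 0 i.
  by rewrite {1}XE mxE.
have tT : t <= T by case/andP: t0T.
exists X; split => //.
- move=> w; split.
    apply: row_continuous => i.
    have -> : (fun r => X r w 0 i) = (fun r => x 0 i +
        parameterized_integral mu t r (fun q => field u v q (X q w) w 0 i)).
      by apply/funext => r; rewrite XE'.
    move=> r; apply: cvgD; first exact: cvg_cst.
    apply: parameterized_integral_continuous => //.
    apply: (bounded_integrable_itv (M := M)); first exact: measurable_section (mF _ mX).
    by move=> q; exact: le_trans (row_coord_le _ i) (bM _ _ _ _ _).
  move=> r /andP[tr rT] i; rewrite XE'; congr (_ + _).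
  by rewrite (int_fieldE u v (X ^~ w)).
- move=> w Y [cY YE].
  pose Y' q (_ : W) := if t <= q <= T then Y q else 0.
  have mY' : jointly_measurable Y'.
    move=> i; suff mYi : measurable_fun setT (fun q : measurableTypeR R => Y' q point 0 i).
      exact: (measurableT_comp mYi measurable_fst).
    have cc : continuous (fun A : 'rV[R]_d => A 0 i) by exact: coord_continuous.
    have cYi : {within `[t, T], continuous (fun q => Y q 0 i)}.
      by move=> q; exact: (continuous_comp (cY q) (cc _)).
    have mYi := subspace_continuous_measurable_fun (measurable_itv _) cYi.
    have /(measurable_restrictT _ (measurable_itv _)) := mYi.
    apply: eq_measurable_fun => q _; rewrite patchE mem_setE in_itv/= /Y'.
    by case: ifP => //; rewrite mxE.
  have Y'E r : t <= r <= T -> Y' r w = picard (field u v) t x Y' r w.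
    move=> trT; rewrite /Y' trT; apply/rowP => i; rewrite (YE _ trT) mxE.
    congr (_ + _); rewrite (int_fieldE u v Y w); last by case/andP: trT.
    apply: eq_Rintegral => q; rewrite inE/= in_itv/= => /andP[tq qr].
    by rewrite tq (le_trans qr)//; case/andP: trT.
  have tTT : t <= T <= T by rewrite tT lexx.
  have <- : Y' T w = Y T by rewrite /Y' tTT.
  apply: (picard_unique mF (bM u v) (lk u v) k0 mY' mX Y'E _ tTT).
  by move=> r _; rewrite {1}XE.
Qed.

Lemma trajectoryP (x : 'rV[R]_d) u v :
  measurable_process u -> measurable_process v -> forall w,
  is_trajectory f T t x (u ^~ w) (v ^~ w) (trajectory f T t x (u ^~ w) (v ^~ w)).
Proof.
move=> mu_ mv w; have [X [_ Xtraj _]] := trajectory_exists x mu_ mv.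
rewrite /trajectory; set S := [set Y | _]; apply: (@getPex _ S).
by exists (X ^~ w); exact: Xtraj.
Qed.

Lemma measurable_trajectory (x : 'rV[R]_d) u v i :
  measurable_process u -> measurable_process v ->
  measurable_fun setT (fun w => trajectory f T t x (u ^~ w) (v ^~ w) T 0 i).
Proof.
move=> mu_ mv; have [X [mX _ Xu]] := trajectory_exists x mu_ mv.
rewrite (_ : (fun w => _) = (fun w => X T w 0 i)).
  exact: (@measurable_fun_pair2 _ _ _ _ _ _
  (fun z : measurableTypeR R * W => X z.1 z.2 0 i) T (mX i)).
by apply/funext => w; rewrite (Xu w _ (trajectoryP x mu_ mv w)).
Qed.

(** A trajectory for (u, v) solves the equation for (u', v') as well, the
    integrands being almost everywhere equal. *)
Lemma ae_eq_trajectory (x : 'rV[R]_d) u v u' v' w :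
  measurable_process u -> measurable_process v ->
  measurable_process u' -> measurable_process v' ->
  {ae mu, forall q : measurableTypeR R, t <= q <= T -> u q w = u' q w /\ v q w = v' q w} ->
  trajectory f T t x (u ^~ w) (v ^~ w) T = trajectory f T t x (u' ^~ w) (v' ^~ w) T.
Proof.
move=> mu_ mv mu' mv' uv.
have [X [mX Xtraj Xu]] := trajectory_exists x mu_ mv.
have [X' [_ _ Xu']] := trajectory_exists x mu' mv'.
rewrite (Xu _ _ (trajectoryP x mu_ mv w)) (Xu' _ _ (trajectoryP x mu' mv' w)).
apply: (Xu' w (X ^~ w)).
have [cX XE] := Xtraj w; split => // r trT i; rewrite XE//; congr (_ + _).
have rT : r <= T by case/andP: trT.
rewrite (int_fieldE u v (X ^~ w))// (int_fieldE u' v' (X ^~ w))//.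
congr fine; apply: ae_eq_integral => //.
- apply/measurable_EFinP/measurable_funTS.
  exact: (measurable_section _ _ (field_measurable mu_ mv mX)).
- apply/measurable_EFinP/measurable_funTS.
  exact: (measurable_section _ _ (field_measurable mu' mv' mX)).
- apply: filterS uv.
  by move=> q h _; rewrite /field; case: ifP => // /h[-> ->].
Qed.

End trajectory.

(** * Information and controls *)

Section information.
Variable R : realType.
Implicit Types (i j : nat) (A B D : set (Omega R)).

Lemma calF_sigma_algebra i : sigma_algebra setT (@calF R i).
Proof. exact: smallest_sigma_algebra. Qed.

Lemma calF_measurable i : @calF R i `<=` measurable.
Proof.
apply: sub_sigma_algebra2 => A [j /= /andP[j0 _] jA].
by exists j.
Qed.

Lemma calF_le i j : (i <= j)%N -> @calF R i `<=` @calF R j.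
Proof.
move=> ij; apply: sub_sigma_algebra2 => A [k /= /andP[k0 ki] kA].
by exists k => //=; rewrite k0 (leq_trans ki).
Qed.

Lemma calFI i A B : calF i A -> calF i B -> calF i (A `&` B).
Proof.
exact: (@measurableI _ (g_sigma_algebraType (\bigcup_(k in [set k | (0 < k <= i)%N])
  preimage_set_system setT (@zeta R k) measurable))).
Qed.

Lemma calFC i A : calF i A -> calF i (~` A).
Proof.
exact: (@measurableC _ (g_sigma_algebraType (\bigcup_(k in [set k | (0 < k <= i)%N])
  preimage_set_system setT (@zeta R k) measurable))).
Qed.

Lemma calFU i A B : calF i A -> calF i B -> calF i (A `|` B).
Proof.
exact: (@measurableU _ (g_sigma_algebraType (\bigcup_(k in [set k | (0 < k <= i)%N])
  preimage_set_system setT (@zeta R k) measurable))).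
Qed.

Lemma calF0 i : @calF R i set0. Proof. by case: (calF_sigma_algebra i). Qed.

Lemma calFT i : @calF R i setT. Proof. by have := calFC (@calF0 i); rewrite setC0. Qed.

(** The stopping times through which nonanticipation is localized on [D]. *)
Lemma stopping_time_if D i k : calF i D -> (i <= k)%N ->
  stopping_time (fun w : Omega R => if w \in D then k else i).
Proof.
move=> FD ik j.
have -> : (fun w : Omega R => if w \in D then k else i) @^-1` [set j] =
    (D `&` [set _ | k == j]) `|` (~` D `&` [set _ | i == j]).
  apply/seteqP; split=> w /=.
    case: ifPn => [/set_mem Dw /eqP|/negP nDw /eqP]; [by left|right].
    by split => // Dw; apply: nDw; rewrite inE.
  move=> [[Dw /eqP <-]|[nDw /eqP <-]]; first by rewrite mem_set.
  by rewrite memNset.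
apply: calFU.
  case: (eqVneq k j) => [<-|_]; last by rewrite set_false setI0; exact: calF0.
  by rewrite set_true setIT; exact: calF_le FD.
case: (eqVneq i j) => [<-|_]; last by rewrite set_false setI0; exact: calF0.
by rewrite set_true setIT; exact: calFC.
Qed.

End information.

Lemma tpt_le (R : realType) (T : R) (s : seq R) i j : itv_partition 0 T s ->
  (i <= j <= size s)%N -> tpt s i <= tpt s j.
Proof.
move=> [ps _] /andP[ij js]; rewrite /tpt.
have ss : sorted <=%R (0 :: s).
  by rewrite /=; apply: sub_path ps => a b; exact: ltW.
apply: (sorted_leq_nth le_trans lexx 0 ss) => //; rewrite inE /= ltnS//.
exact: leq_trans js.
Qed.

Lemma tpt_size (R : realType) (T : R) (s : seq R) : itv_partition 0 T s ->
  tpt s (size s) = T.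
Proof. by move=> [_ /eqP <-]; rewrite /tpt -last_nth. Qed.

Section paste.
Variables (R : realType) (E : pmetricType R).
Variables (K : nat -> set (set (Omega R))) (T : R) (s : seq R) (t t' : R).
Hypothesis hs : itv_partition 0 T s.
Implicit Types (u : process R E) (D : set (Omega R)).

Definition paste D u1 u2 : process R E :=
  fun r w => if w \in D then u1 r w else u2 r w.

(** Before time t_i the control [v1] is used unchanged, because [D] is not yet
    known there; this does not matter on [t, t']. From stage i + 1 on, the
    partitions of both controls are refined by [D] and its complement and
    interleaved along even and odd indices. *)
Lemma controls_paste (i : nat) D u1 u2 : (i <= size s)%N -> tpt s i <= t ->
  calF i D -> controls K T s t t' u1 -> controls K T s t t' u2 ->
  controls K T s t t' (paste D u1 u2).
Proof.
move=> i_lt ti_le FD [v1 [[mv1 pv1] dv1] <-] [v2 [[mv2 pv2] dv2] <-].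
have mD := calF_measurable FD.
pose C (z : measurableTypeR R * Omega R) := (z.1 < tpt s i) || (z.2 \in D).
pose v r w := if (r < tpt s i) || (w \in D) then v1 r w else v2 r w.
exists v; last first.
  apply/funext => r; apply/funext => w; rewrite /paste !patchE.
  case: ifPn => [|_]; last by case: ifP.
  rewrite inE/= in_itv/= => /andP[tr _].
  by rewrite /v ltNge (le_trans ti_le tr)/=.
split; first split.
- have mC : measurable_fun (`[0, T] `*` setT : set (measurableTypeR R * Omega R)) C.
    apply: measurable_funTS; apply: measurable_or.
      by apply: measurable_fun_ltr.
    apply: (measurable_fun_bool true) => //.
    have mD2 : measurable (setT `*` D : set (measurableTypeR R * Omega R)).
      exact: measurableX.
    move: mD2; congr measurable; apply/seteqP; split => z /= [_ Dz].
      by split => //=; rewrite mem_set.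
    by split => //; exact: set_mem.
  apply: (@measurable_fun_if _ _ _ _ (fun z : measurableTypeR R * Omega R => v1 z.1 z.2 : borel E)
    (fun z => v2 z.1 z.2 : borel E)) mC _ _.
  + by apply: measurableX.
  + by apply: measurable_funS mv1; [exact: measurableX|exact: subIsetl].
  + by apply: measurable_funS mv2; [exact: measurableX|exact: subIsetl].
- move=> r r0T _ [B mB <-]; rewrite setTI.
  have m1 : measurable (v1 r @^-1` B : set (Omega R)).
    by apply: (pv1 r r0T); exists B => //; rewrite setTI.
  have m2 : measurable (v2 r @^-1` B : set (Omega R)).
    by apply: (pv2 r r0T); exists B => //; rewrite setTI.
  have [ri|ir] := ltP r (tpt s i).
    by move: m1; congr measurable; apply/seteqP; split => w; rewrite /= /v ri.
  rewrite (_ : _ @^-1` _ = (D `&` v1 r @^-1` B) `|` (~` D `&` v2 r @^-1` B)).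
    apply: measurableU; apply: measurableI => //.
    exact: measurableC.
  apply/seteqP; split=> w /=; rewrite /v ltNge ir/=.
    by case: ifPn => [/set_mem ? ?|/negP]; [left|rewrite in_setE; right].
  by move=> [[Dw]|[nDw]]; [rewrite mem_set|rewrite memNset].
move=> j /andP[j0 js].
have [ji|ij] := leqP j i.
  have [G [w_ [G1 G2 G3 G4 G5]]] := dv1 j ltac:(by rewrite j0).
  exists G, w_; split => // k r w /andP[jr rj] Gkw.
  rewrite /v (lt_le_trans rj)/=; last by apply: (tpt_le hs); rewrite ji.
  by apply: G5 => //; rewrite jr.
have [G [w_ [G1 G2 G3 G4 G5]]] := dv1 j ltac:(by rewrite j0).
have [G' [w_' [G1' G2' G3' G4' G5']]] := dv2 j ltac:(by rewrite j0).
have FDj : calF j.-1 D by apply: calF_le FD; rewrite -ltnS prednK.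
exists (fun k => if odd k then ~` D `&` G' k./2 else D `&` G k./2),
  (fun k => if odd k then w_' k./2 else w_ k./2); split.
- by move=> k; case: ifP => _; apply: calFI => //; exact: calFC.
- apply/trivIsetP => k l _ _ kl; apply/seteqP; split => // w [].
  have tG k' l' w' : G k' w' -> G l' w' -> k' = l'.
    by move=> h h'; apply: (G2 k' l') => //; exists w'.
  have tG' k' l' w' : G' k' w' -> G' l' w' -> k' = l'.
    by move=> h h'; apply: (G2' k' l') => //; exists w'.
  move/eqP: kl; rewrite -{1}(odd_double_half k) -{1}(odd_double_half l).
  case: (odd k); case: (odd l) => kl [D1 H1] [D2 H2] //.
    by apply: kl; rewrite (tG' _ _ _ H1 H2).
  by apply: kl; rewrite (tG _ _ _ H1 H2).
- apply/seteqP; split=> w // _; have [Dw|nDw] := pselect (D w).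
    have : (\bigcup_k G k) w by rewrite G3.
    move=> [k _ Gk]; exists k.*2 => //=.
    by rewrite odd_double doubleK.
  have : (\bigcup_k G' k) w by rewrite G3'.
  move=> [k _ Gk]; exists k.*2.+1 => //=.
  by rewrite odd_double/= uphalf_double.
- by move=> k; case: ifP.
- move=> k r w jrj; have ir : tpt s i <= r.
    case/andP: jrj => jr _; apply: le_trans jr; apply: (tpt_le hs).
    by rewrite -ltnS prednK// ij (leq_trans (leq_pred _)).
  rewrite /v ltNge ir/=; case: ifP => _ [Dw Gw].
    by rewrite memNset//; apply: G5'.
  by rewrite mem_set//; apply: G5.
Qed.

Lemma controls_nonempty : (forall j, K j set0 /\ K j setT) ->
  @controls R E K T s t t' !=set0.
Proof.
move=> KT; exists ((fun _ _ => point) \_ `[t, t'] : process R E), (fun _ _ => point) => //.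
have pre (B : set (borel E)) : setT `&` (fun _ : Omega R => (point : E)) @^-1` B = set0 \/
    setT `&` (fun _ : Omega R => (point : E)) @^-1` B = setT.
  have [Bp|nBp] := pselect (B point); [right|left]; rewrite setTI.
    by apply/seteqP; split.
  by apply/seteqP; split.
have L0c (K' : set (set (Omega R))) a b : K' set0 -> K' setT ->
    L0 K' a b (fun _ _ => point : E).
  move=> K0 K1; split; first exact: measurable_cst.
  by move=> r _ _ [B mB <-]; case: (pre B) => ->.
split; first by apply: L0c.
move=> j _; exists (fun k => if k == 0%N then setT else set0), (fun _ _ _ => point); split.
- by move=> k; case: ifP => _; [exact: calFT|exact: calF0].
- apply/trivIsetP => k l _ _ kl; case: (eqVneq k 0%N) => [k0|]; last by rewrite set0I.
  by case: (eqVneq l 0%N) => [l0|]; [rewrite k0 l0 eqxx in kl|rewrite setI0].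
- by apply/seteqP; split => // w _; exists 0%N.
- by move=> k; apply: L0c; case: (KT j).
- by [].
Qed.

End paste.

(** * Strategies and outcomes *)

Section strategies.
Variables (R : realType) (P : probability (Omega R) R) (T : R) (s : seq R) (t : R).
Hypothesis hs : itv_partition 0 T s.
Variable i : nat.
Hypotheses (i_lt : (i < size s)%N) (ti_le : tpt s i <= t).

Definition agree_on (E : Type) (D : set (Omega R)) (k : nat) (u u' : process R E) :=
  {ae dsdP P, forall z : measurableTypeR R * Omega R,
    D z.2 -> t <= z.1 <= tpt s k -> z.1 <= T -> u z.1 z.2 = u' z.1 z.2}.

Lemma ae_neq_time (r : R) :
  {ae dsdP P, forall z : measurableTypeR R * Omega R, z.1 != r}.
Proof.
exists ([set r : measurableTypeR R] `*` setT); split.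
- by apply: measurableX.
- transitivity (@lebesgue_measure R [set r] * P setT)%E.
    exact: product_measure1E.
  by rewrite lebesgue_measure_set1 mul0e.
- by move=> z /= /negP; rewrite negbK => /eqP.
Qed.

(** Up to t_i only the time [t] itself may be left, which is a null set. *)
Lemma agree_on_start (E : Type) D (u u' : process R E) : agree_on D i u u'.
Proof.
apply: filterS (ae_neq_time t) => z zt _ /andP[tz zi] _.
by move: zt; rewrite eq_le tz (le_trans zi ti_le).
Qed.

Lemma agree_on_sym (E : Type) D k (u u' : process R E) :
  agree_on D k u u' -> agree_on D k u' u.
Proof. by apply: filterS => z h ? ? ?; rewrite h. Qed.

Lemma agree_on_trans (E : Type) D k (u u' u'' : process R E) :
  agree_on D k u u' -> agree_on D k u' u'' -> agree_on D k u u''.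
Proof. by apply: filterS2 => z h h' ? ? ?; rewrite h// h'. Qed.

(** Nonanticipation on an event [D] of F_i: off [D] the stopping time is equal
    to [i], and up to t_i there is nothing to check. *)
Lemma nad_local (E E' : Type) (A : set (process R E)) (B : set (process R E'))
    beta D k u u' : nad_strategies P s t T A B beta ->
  calF i D -> (i <= k < size s)%N -> A u -> A u' ->
  agree_on D k u u' -> agree_on D k.+1 (beta u) (beta u').
Proof.
move=> [_ nad] FD /andP[ik ks] Au Au' uu'.
pose tau (w : Omega R) := if w \in D then k else i.
have tau_s w : (tau w < size s)%N by rewrite /tau; case: ifP.
have uu'_tau : {ae dsdP P, forall z : measurableTypeR R * Omega R,
    t <= z.1 <= tpt s (tau z.2) -> z.1 <= T -> u z.1 z.2 = u' z.1 z.2}.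
  move: uu' (ae_neq_time t); apply: filterS2 => z h zt; rewrite /tau.
  case: ifPn => [/set_mem Dz|_]; first exact: h.
  move=> /andP[tz zi] _.
  by move: zt; rewrite eq_le tz (le_trans zi ti_le).
have := nad tau (stopping_time_if FD ik) tau_s u u' Au Au' uu'_tau.
by apply: filterS => z h Dz; move: h; rewrite /tau mem_set.
Qed.

Lemma nad_paste (E : Type) (E' : pmetricType R) K (A : set (process R E)) D beta1 beta2 :
  let B := @controls R E' K T s t T in
  calF i D ->
  nad_strategies P s t T A B beta1 -> nad_strategies P s t T A B beta2 ->
  nad_strategies P s t T A B (fun u => paste D (beta1 u) (beta2 u)).
Proof.
move=> B FD [AB1 nad1] [AB2 nad2]; split.
  move=> u Au; apply: (controls_paste hs (ltnW i_lt) ti_le FD); [exact: AB1|exact: AB2].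
move=> tau st tau_s u u' Au Au' uu'.
have h1 := nad1 tau st tau_s u u' Au Au' uu'.
have h2 := nad2 tau st tau_s u u' Au Au' uu'.
move: h1 h2; apply: filterS2 => z h1 h2 tz zT; rewrite /paste.
by case: ifP => _; [exact: h1|exact: h2].
Qed.

Lemma nad_nonempty (E : Type) (E' : Type) (A : set (process R E)) (B : set (process R E')) :
  B !=set0 -> nad_strategies P s t T A B !=set0.
Proof.
move=> [v Bv]; exists (fun=> v); split; first by move=> u _.
by move=> tau _ _ u u' _ _ _; exact: aeW.
Qed.

Section outcomes.
Variables U V : pmetricType R.
Local Notation CU := (@calU R U T s t T).
Local Notation CV := (@calV R V T s t T).
Local Notation SA := (@calA R U V P T s t T).
Local Notation SB := (@calB R U V P T s t T).

Lemma agree_on_size (E : Type) D (u u' : process R E) :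
  agree_on D (size s) u u' <->
  {ae dsdP P, forall z : measurableTypeR R * Omega R,
    D z.2 -> t <= z.1 <= T -> u z.1 z.2 = u' z.1 z.2}.
Proof.
rewrite /agree_on (tpt_size hs); split; apply: filterS => z h Dz tz.
  by apply: h => //; case/andP: tz.
by move=> _; exact: h.
Qed.

Lemma is_outcomeP alpha beta u v : is_outcome P T s t T alpha beta (u, v) <->
  [/\ CU u, CV v, agree_on setT (size s) (alpha v) u &
      agree_on setT (size s) (beta u) v].
Proof.
split=> -[h1 h2 h3 h4]; split => //.
- by apply/agree_on_size; apply: filterS h3 => z h _.
- by apply/agree_on_size; apply: filterS h4 => z h _.
- by move/agree_on_size: h3; apply: filterS => z h; exact: h.
- by move/agree_on_size: h4; apply: filterS => z h; exact: h.
Qed.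

Lemma calU_nonempty : CU !=set0.
Proof.
apply: controls_nonempty => j; split.
  by exists set0; [exact: measurable0|apply/seteqP; split=> w []].
by exists setT; [exact: measurableT|apply/seteqP; split=> w].
Qed.

Lemma calV_nonempty : CV !=set0.
Proof.
apply: controls_nonempty => j; split.
  by exists set0; [exact: measurable0|apply/seteqP; split=> w []].
by exists setT; [exact: measurableT|apply/seteqP; split=> w].
Qed.

(** The iteration of (u, v) |-> (alpha v, beta u) from arbitrary controls
    becomes stationary up to null sets, one stage at each step, since alpha
    and beta determine the controls on a stage from the previous stages. *)
Lemma outcomeP alpha beta : SA alpha -> SB beta ->
  is_outcome P T s t T alpha beta (outcome P T s t T alpha beta).
Proof.
move=> Sa Sb; rewrite /outcome; set S := [set uv | _]; apply: (@getPex _ S).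
have [u0 CU0] := calU_nonempty.
have [v0 CV0] := calV_nonempty.
pose uv n := iter n (fun uv => (alpha uv.2, beta uv.1)) (u0, v0).
have [aAB _] := Sa; have [bAB _] := Sb.
have Cuv n : CU (uv n).1 /\ CV (uv n).2.
  by elim: n => [//|n [IHu IHv]]; split; [exact: aAB|exact: bAB].
have step n : (i + n <= size s)%N ->
    agree_on setT (i + n) (uv n.+1).1 (uv n).1 /\
    agree_on setT (i + n) (uv n.+1).2 (uv n).2.
  elim: n => [|n IH] ns.
    by rewrite addn0; split; exact: agree_on_start.
  have [IHu IHv] := IH (leq_trans (leq_add (leqnn i) (leqnSn n)) ns).
  rewrite addnS in ns *; split.
    by apply: (nad_local Sa (@calFT R i)) => //;
      [rewrite leq_addr|exact: (Cuv n.+1).2|exact: (Cuv n).2].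
  by apply: (nad_local Sb (@calFT R i)) => //;
      [rewrite leq_addr|exact: (Cuv n.+1).1|exact: (Cuv n).1].
(* Stages i + 1 to size s are settled after size s - i iterations. *)
have [h1 h2] := step (size s - i)%N ltac:(by rewrite subnKC// ltnW).
exists (uv (size s - i)%N); rewrite /S /= [X in is_outcome _ _ _ _ _ _ _ X]surjective_pairing.
have [c1 c2] := Cuv (size s - i)%N.
rewrite subnKC ?(ltnW i_lt)// in h1 h2.
by apply/is_outcomeP; split.
Qed.

(** Uniqueness of outcomes, localized on an event [D] of F_i: if the
    strategies coincide on [D], so do the outcomes, by induction on the stages. *)
Lemma outcome_local alpha beta alpha' beta' u v u' v' D :
  SA alpha -> SB beta -> calF i D ->
  (forall v, CV v -> agree_on D (size s) (alpha v) (alpha' v)) ->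
  (forall u, CU u -> agree_on D (size s) (beta u) (beta' u)) ->
  is_outcome P T s t T alpha beta (u, v) ->
  is_outcome P T s t T alpha' beta' (u', v') ->
  agree_on D (size s) u u' /\ agree_on D (size s) v v'.
Proof.
move=> Sa Sb FD aa' bb' /is_outcomeP[Cu Cv au bu] /is_outcomeP[Cu' Cv' au' bu'].
have sub (E : Type) k (w w' : process R E) : (k <= size s)%N ->
    agree_on D (size s) w w' -> agree_on D k w w'.
  move=> ks; apply: filterS => z h Dz /andP[tz zk] zT; apply: h => //.
  by rewrite tz (le_trans zk)// (tpt_le hs)// ks leqnn.
have subT (E : Type) k (w w' : process R E) : (k <= size s)%N ->
    agree_on setT (size s) w w' -> agree_on D k w w'.
  by move=> ks h; apply: (sub _ _ _ _ ks); apply: filterS h => z h _; exact: h.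
have key n : (i + n <= size s)%N -> agree_on D (i + n) u u' /\ agree_on D (i + n) v v'.
  elim: n => [|n IH] ns; first by rewrite addn0; split; exact: agree_on_start.
  have [IHu IHv] := IH (leq_trans (leq_add (leqnn i) (leqnSn n)) ns).
  have ns' := ns; rewrite addnS in ns *.
  have ik : (i <= i + n < size s)%N by rewrite leq_addr.
  split.
    apply: agree_on_trans (agree_on_sym (subT _ _ _ _ ns au)) _.
    apply: agree_on_trans (nad_local Sa FD ik Cv Cv' IHv) _.
    apply: agree_on_trans (sub _ _ _ _ ns (aa' _ Cv')) _.
    exact: subT.
  apply: agree_on_trans (agree_on_sym (subT _ _ _ _ ns bu)) _.
  apply: agree_on_trans (nad_local Sb FD ik Cu Cu' IHu) _.
  apply: agree_on_trans (sub _ _ _ _ ns (bb' _ Cu')) _.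
  exact: subT.
have := key (size s - i)%N; rewrite subnKC ?(ltnW i_lt)//; exact.
Qed.

End outcomes.
End strategies.

(** * The values of the game *)

(** Fubini's theorem for null sets. *)
Lemma ae_section (R : realType) (P : probability (Omega R) R)
    (Q : measurableTypeR R * Omega R -> Prop) :
  {ae dsdP P, forall z, Q z} ->
  {ae P, forall w, {ae @lebesgue_measure R, forall q, Q (q, w)}}.
Proof.
move=> [N [mN N0 QN]].
have mf : measurable_fun setT (EFin \o \1_N : measurableTypeR R * Omega R -> \bar R).
  by apply/measurable_EFinP; exact: measurable_indic.
have f0 z : (0 <= (EFin \o (\1_N : measurableTypeR R * Omega R -> R)) z)%E.
  by rewrite /= lee_fin.
have := fubini_tonelli2 (m1 := @lebesgue_measure R) (m2 := P) _ mf f0.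
rewrite integral_indic// setIT.
rewrite [X in (X = _) -> _](_ : _ = 0%E); last exact: N0.
rewrite (_ : fubini_G _ _ = fun w => lebesgue_measure (ysection N w)); last first.
  apply/funext => w; rewrite /fubini_G.
  rewrite (_ : (fun x => _) = fun q => (\1_(ysection N w) q)%:E).
    rewrite integral_indic ?setIT//; exact: measurable_ysection.
  by apply/funext => q; rewrite /= !indicE mem_ysection.
move=> /esym int0.
have mg : measurable_fun setT (fun w : Omega R => @lebesgue_measure R (ysection N w)).
  exact: measurable_fun_ysection.
have /(ae_eq_integral_abs P measurableT mg) :
    (\int[P]_(w in setT) `|@lebesgue_measure R (ysection N w)| = 0)%E.
  by rewrite -[RHS]int0; apply: eq_integral => w _; rewrite gee0_abs.
apply: filterS => w /(_ I) Nw0; exists (ysection N w); split.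
- exact: measurable_ysection.
- exact: Nw0.
- by move=> q nQ; apply/mem_set; exact: QN.
Qed.

Lemma lipschitz_row_continuous (R : realType) (d : nat) (g : 'rV[R]_d -> R) :
  (exists k : R, forall y y', `|g y - g y'| <= k * `|y - y'|) -> continuous g.
Proof.
move=> [k gk] y; apply/(@cvgrPdist_lt _ _ _ (nbhs y) _ g (g y)) => e e0.
have k0 : 0 < `|k| + 1 by rewrite ltr_wpDl.
have c0 : 0 < (`|k| + 1)^-1 * e by rewrite mulr_gt0// invr_gt0.
apply: (@filterS _ (nbhs y) (nbhs_filter y) _ _ _ (nbhsx_ballx y _ c0)) => y'.
rewrite mx_norm_ball/= => yy'; apply: (le_lt_trans (gk y y')).
apply: (@le_lt_trans _ _ ((`|k| + 1) * `|y - y'|)).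
  by rewrite ler_wpM2r// (le_trans (ler_norm _))// lerDl.
by rewrite -ltr_pdivlMl.
Qed.

Lemma controls_measurable (R : realType) (E : pmetricType R) K (T : R) s (t : R) u :
  0 <= t -> @controls R E K T s t T u -> measurable_process T t u.
Proof.
move=> t0 [u0 [[mu0 _] _] <-].
have mI : measurable (`[t, T] `*` setT : set (measurableTypeR R * Omega R)).
  by apply: measurableX.
have mI0 : measurable (`[0, T] `*` setT : set (measurableTypeR R * Omega R)).
  by apply: measurableX.
have sub : `[t, T] `*` setT `<=` (`[0, T] `*` setT : set (measurableTypeR R * Omega R)).
  move=> z [] /=; rewrite in_itv/= => /andP[tz zT] _; split => //=.
  by rewrite in_itv/= (le_trans t0 tz).
apply: eq_measurable_fun (measurable_funS mI0 sub mu0).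
by move=> z; rewrite inE => -[z1 _]; rewrite patchE mem_set.
Qed.

Section values.
Variables (R : realType) (d : nat) (T : R) (U V : pmetricType R).
Variables (f : R -> 'rV[R]_d -> U -> V -> 'rV[R]_d) (g : 'rV[R]_d -> R).
Variables (P : probability (Omega R) R) (s : seq R) (t : R) (x : 'rV[R]_d).
Hypotheses (hT : 0 < T) (hU : compact [set: U]) (hV : compact [set: V]).
Hypothesis f_bounded : exists M : R,
  forall (r : R) y u v, 0 <= r <= T -> `|f r y u v| <= M.
Hypothesis f_continuous :
  {within [set z : R * 'rV[R]_d * U * V | 0 <= z.1.1.1 <= T],
    continuous (fun z => f z.1.1.1 z.1.1.2 z.1.2 z.2)}.
Hypothesis f_lipschitz : exists k : R, forall (r : R) u v y y', 0 <= r <= T ->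
  `|f r y u v - f r y' u v| <= k * `|y - y'|.
Hypothesis g_bounded : exists M : R, forall y, `|g y| <= M.
Hypothesis g_lipschitz : exists k : R, forall y y', `|g y - g y'| <= k * `|y - y'|.
Hypothesis hs : itv_partition 0 T s.

Local Notation A := (@calA R U V P T s t T).
Local Notation B := (@calB R U V P T s t T).
Local Notation J := (payoff f g P T s t x).

Let A0 : A !=set0. Proof. exact/nad_nonempty/calU_nonempty. Qed.
Let B0 : B !=set0. Proof. exact/nad_nonempty/calV_nonempty. Qed.

Section before_terminal.
Hypothesis t0T : 0 <= t < T.

Local Notation i := (stage s t).
Let i_lt : (i < size s)%N. Proof. by have [] := stageP hs t0T. Qed.
Let ti_le : tpt s i <= t. Proof. by have [_ /andP[]] := stageP hs t0T. Qed.
Let t0 : 0 <= t. Proof. by case/andP: t0T. Qed.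
Let t0T' : 0 <= t <= T. Proof. by case/andP: t0T => -> /ltW. Qed.

Let outcome_controls alpha beta : A alpha -> B beta ->
  measurable_process T t (outcome P T s t T alpha beta).1 /\
  measurable_process T t (outcome P T s t T alpha beta).2.
Proof.
move=> Aa Bb; have [Cu Cv _ _] := outcomeP hs i_lt ti_le Aa Bb.
by split; [exact: controls_measurable t0 Cu|exact: controls_measurable t0 Cv].
Qed.

Lemma measurable_payoff alpha beta : A alpha -> B beta ->
  measurable_fun setT (J alpha beta).
Proof.
move=> Aa Bb; have [mu mv] := outcome_controls Aa Bb.
apply: (measurable_continuous_row measurableT (lipschitz_row_continuous g_lipschitz)).
by move=> j; apply: measurable_trajectory.
Qed.

Lemma payoff_bounded : exists M, forall alpha beta w, `|J alpha beta w| <= M.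
Proof. by have [M gM] := g_bounded; exists M => ? ? ?; exact: gM. Qed.

Lemma integrable_payoff alpha beta : A alpha -> B beta ->
  P.-integrable setT (EFin \o J alpha beta).
Proof.
move=> Aa Bb; have [M JM] := payoff_bounded.
apply: (@ae_bounded_integrable _ _ _ _ _ M).
  by apply/measurable_EFinP; exact: measurable_payoff.
by apply: aeW => w; rewrite /= lee_fin.
Qed.

(** The form in which the localization of outcomes is used: conditional
    payoffs on [D] see only the strategies played on [D]. *)
Lemma payoff_local alpha beta alpha' beta' D :
  A alpha -> B beta -> A alpha' -> B beta' -> calF i D ->
  (forall v w, D w -> alpha v ^~ w = alpha' v ^~ w) ->
  (forall u w, D w -> beta u ^~ w = beta' u ^~ w) ->
  {ae P, forall w, D w -> J alpha beta w = J alpha' beta' w}.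
Proof.
move=> Aa Bb Aa' Bb' FD aa' bb'.
have := outcomeP hs i_lt ti_le Aa Bb; have := outcomeP hs i_lt ti_le Aa' Bb'.
have [mu mv] := outcome_controls Aa Bb; have [mu' mv'] := outcome_controls Aa' Bb'.
rewrite /payoff /state.
case: (outcome P T s t T alpha' beta') mu' mv' => u' v' /= mu' mv' o'.
case: (outcome P T s t T alpha beta) mu mv => u v /= mu mv o.
have aD (w : process R V) : agree_on P T s t D (size s) (alpha w) (alpha' w).
  by apply: aeW => z Dz _ _; have /(congr1 (fun h => h z.1)) := aa' w z.2 Dz.
have bD (w : process R U) : agree_on P T s t D (size s) (beta w) (beta' w).
  by apply: aeW => z Dz _ _; have /(congr1 (fun h => h z.1)) := bb' w z.2 Dz.
have [] := outcome_local hs i_lt ti_le Aa Bb FD (fun v _ => aD v) (fun u _ => bD u) o o'.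
move=> /(agree_on_size _ _ hs) uu' /(agree_on_size _ _ hs) vv'.
have uv : {ae dsdP P, forall z : measurableTypeR R * Omega R, D z.2 -> t <= z.1 <= T ->
    u z.1 z.2 = u' z.1 z.2 /\ v z.1 z.2 = v' z.1 z.2}.
  by move: uu' vv'; apply: filterS2 => z h h' Dz tz; split; [exact: h|exact: h'].
have := ae_section uv; apply: filterS => w h Dw; congr g.
apply: (ae_eq_trajectory t0T' hU hV) => //.
by apply: filterS h => q h tq; exact: h.
Qed.

Let pasteA D a1 a2 : calF i D -> A a1 -> A a2 -> exists2 a3, A a3 & forall b, B b ->
  {ae P, forall w, D w -> J a3 b w = J a1 b w} /\
  {ae P, forall w, ~ D w -> J a3 b w = J a2 b w}.
Proof.
move=> FD Aa1 Aa2; exists (fun v => paste D (a1 v) (a2 v)).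
  exact: (nad_paste hs i_lt ti_le FD Aa1 Aa2).
have Aa3 := nad_paste hs i_lt ti_le FD Aa1 Aa2.
move=> b Bb; split.
  apply: payoff_local => // v w Dw; apply/funext => r; by rewrite /paste mem_set.
apply: (payoff_local (D := ~` D)) => //; first exact: calFC.
by move=> v w Dw; apply/funext => r; rewrite /paste memNset.
Qed.

Let pasteB D b1 b2 : calF i D -> B b1 -> B b2 -> exists2 b3, B b3 & forall a, A a ->
  {ae P, forall w, D w -> J a b3 w = J a b1 w} /\
  {ae P, forall w, ~ D w -> J a b3 w = J a b2 w}.
Proof.
move=> FD Bb1 Bb2; exists (fun v => paste D (b1 v) (b2 v)).
  exact: (nad_paste hs i_lt ti_le FD Bb1 Bb2).
have Bb3 := nad_paste hs i_lt ti_le FD Bb1 Bb2.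
move=> a Aa; split.
  apply: payoff_local => // v w Dw; apply/funext => r; by rewrite /paste mem_set.
apply: (payoff_local (D := ~` D)) => //; first exact: calFC.
by move=> v w Dw; apply/funext => r; rewrite /paste memNset.
Qed.

Let pastA a : A a -> pastable P (calF i) B (J a).
Proof.
move=> Aa D b1 b2 FD Bb1 Bb2; have [b Bb h] := pasteB FD Bb1 Bb2.
by exists b => //; exact: h.
Qed.

Let pastB b : B b -> pastable P (calF i) A (J ^~ b).
Proof.
move=> Bb D a1 a2 FD Aa1 Aa2; have [a Aa h] := pasteA FD Aa1 Aa2.
by exists a => //; exact: h.
Qed.

Let sF : sigma_algebra setT (@calF R i). Proof. exact: calF_sigma_algebra. Qed.
Let Fm : @calF R i `<=` measurable. Proof. exact: calF_measurable. Qed.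

Local Notation Z := (fun a b => cond_exp P (calF i) (J a b)).

Let ZP a b : A a -> B b -> is_cond_exp P (calF i) (J a b) (Z a b).
Proof. by move=> Aa Bb; apply: cond_expP => //; exact: integrable_payoff. Qed.

Lemma integral_lower_rv :
  (\int[P]_w lower_rv f g P T s t x w)%E =
  ereal_sup [set ereal_inf [set \int[P]_w (J a b w)%:E | b in B]%E | a in A].
Proof.
have [M JM] := payoff_bounded.
have JM' a b : A a -> B b -> {ae P, forall w, `|J a b w| <= M} by move=> _ _; exact: aeW.
have infP a : A a -> is_essinf P B (fun b => EFin \o Z a b)
    (essinf P B (fun b => EFin \o Z a b)).
  move=> Aa.
  have [eta [_ h _ _]] := essinf_cond_exp sF Fm B0 (fun b => integrable_payoff Aa (beta := b))
    (fun b => JM' a b Aa) (fun b => ZP Aa (b := b)) (pastA Aa).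
  exact: essinfP h.
have [eta [eta_sup ieta etaE]] := esssup_essinf_cond_exp sF Fm A0 B0
  integrable_payoff JM' ZP pastA pasteA infP.
have supP : is_esssup P A (fun a => essinf P B (fun b => EFin \o Z a b))
    (lower_rv f g P T s t x).
  exact: esssupP eta_sup.
rewrite -etaE; apply: ae_eq_integral => //.
- by case: supP.
- by case: eta_sup.
- by apply: filterS (esssup_unique supP eta_sup) => w h _.
Qed.

Lemma integral_upper_rv :
  (\int[P]_w upper_rv f g P T s t x w)%E =
  ereal_inf [set ereal_sup [set \int[P]_w (J a b w)%:E | a in A]%E | b in B].
Proof.
have [M JM] := payoff_bounded.
have JM' a b : A a -> B b -> {ae P, forall w, `|J a b w| <= M} by move=> _ _; exact: aeW.
have supP b : B b -> is_esssup P A (fun a => EFin \o Z a b)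
    (esssup P A (fun a => EFin \o Z a b)).
  move=> Bb.
  have [eta h] := esssup_cond_exp sF Fm A0 (fun a Aa => integrable_payoff Aa Bb)
    (fun a Aa => JM' a b Aa Bb) (fun a Aa => ZP Aa Bb) (pastB Bb).
  exact: esssupP h.
have [eta [eta_inf ieta etaE]] := essinf_esssup_cond_exp sF Fm A0 B0
  integrable_payoff JM' ZP pastB pasteB supP.
have infP : is_essinf P B (fun b => esssup P A (fun a => EFin \o Z a b))
    (upper_rv f g P T s t x).
  exact: essinfP eta_inf.
rewrite -etaE; apply: ae_eq_integral => //.
- by case: infP.
- by case: eta_inf.
- have := esssup_unique (is_essinfN infP) (is_essinfN eta_inf).
  by apply: filterS => w /oppe_inj h _.
Qed.

End before_terminal.

Lemma sup_inf_const (I I' : Type) (A' : set I) (B' : set I') (F : I -> I' -> \bar R) c :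
  A' !=set0 -> B' !=set0 -> (forall a b, F a b = c) ->
  ereal_sup [set ereal_inf [set F a b | b in B'] | a in A'] = c /\
  ereal_inf [set ereal_sup [set F a b | a in A'] | b in B'] = c.
Proof.
have img (X : Type) (S : set X) (h : X -> \bar R) : S !=set0 ->
    (forall y, h y = c) -> [set h y | y in S] = [set c].
  move=> [y Sy] hc; apply/seteqP; split=> [_ [z _ <-]|_ ->]; first exact: hc.
  by exists y.
move=> A'0 B'0 Fc; split; rewrite img ?ereal_sup1 ?ereal_inf1// => y.
  by rewrite img ?ereal_inf1.
by rewrite img ?ereal_sup1.
Qed.

(** On a time interval reduced to a point the trajectory is the constant [x]. *)
Lemma payoff_terminal alpha beta w : payoff f g P T s T x alpha beta w = g x.
Proof.
rewrite /payoff /state; congr g; rewrite /trajectory; set S := [set X | _].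
have : S (get S).
  apply: (@getPex _ S); exists (fun=> x); split.
    by apply: continuous_subspaceT => r; exact: cvg_cst.
  move=> r; rewrite -eq_le => /eqP <- j.
  by rewrite set_itv1 Rintegral_set1 addr0.
move=> [_ XE]; apply/rowP => j; rewrite XE ?lexx//.
by rewrite set_itv1 Rintegral_set1 addr0.
Qed.

End values.

Theorem theorem3p3 (R : realType) (d : nat) (T : R) (U V : pmetricType R)
    (f : R -> 'rV[R]_d -> U -> V -> 'rV[R]_d) (g : 'rV[R]_d -> R)
    (P : probability (Omega R) R) (s : seq R) (t : R) (x : 'rV[R]_d)
    (hT : 0 < T)
    (hU : compact [set: U]) (hV : compact [set: V])
    (f_bounded : exists M : R, forall (r : R) y u v, 0 <= r <= T -> `|f r y u v| <= M)
    (f_continuous :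
      {within [set z : R * 'rV[R]_d * U * V | 0 <= z.1.1.1 <= T],
        continuous (fun z => f z.1.1.1 z.1.1.2 z.1.2 z.2)})
    (f_lipschitz : exists k : R, forall (r : R) u v y y', 0 <= r <= T ->
      `|f r y u v - f r y' u v| <= k * `|y - y'|)
    (g_bounded : exists M : R, forall y, `|g y| <= M)
    (g_lipschitz : exists k : R, forall y y', `|g y - g y'| <= k * `|y - y'|)
    (hP : is_product_law P)
    (hs : itv_partition 0 T s)
    (ht : 0 <= t <= T) :
  lower_value f g P T s t x =
    ereal_sup [set ereal_inf [set 'E_P[payoff f g P T s t x alpha beta]%E
                             | beta in calB P T s t T]
              | alpha in calA P T s t T] /\
  upper_value f g P T s t x =
    ereal_inf [set ereal_sup [set 'E_P[payoff f g P T s t x alpha beta]%E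
                             | alpha in calA P T s t T]
              | beta in calB P T s t T].
Proof.
have A0 : @calA R U V P T s t T !=set0 by exact/nad_nonempty/calU_nonempty.
have B0 : @calB R U V P T s t T !=set0 by exact/nad_nonempty/calV_nonempty.
have [tT|tT] := eqVneq t T.
  rewrite /lower_value /upper_value tT eqxx.
  have JE a b : ('E_P[payoff f g P T s T x a b] = (g x)%:E)%E.
    rewrite unlock (_ : (fun w => _) = cst (g x)%:E); last first.
      by apply/funext => w; rewrite payoff_terminal.
    rewrite integral_cst// -[RHS]mule1; congr (_ * _)%E.
    exact: probability_setT.
  by rewrite tT in A0 B0; have [-> ->] := sup_inf_const A0 B0 JE.
have t0T : 0 <= t < T by case/andP: ht => -> tleT; rewrite lt_neqAle tT.
rewrite /lower_value /upper_value (negbTE tT) integral_lower_rv// integral_upper_rv//.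
by rewrite unlock.
Qed.
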